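(* Let $A \in L(H)$ be hyperbolic and $\rho > r(A)$. Let $M_1 \coloneqq \sup_{z\in S_1}|(z-A)^{-1}|_{L(H)}$ and $M_\rho \coloneqq \sup_{z\in S_\rho}|(z-A)^{-1}|_{L(H)}$. Let $F\colon \operatorname{cc}(\mathbb{Z};H)\to \ell_{2}(\mathbb{Z};H)\cap\ell_{2,\rho}(\mathbb{Z};H)$ be $(1,\rho)$-admissible, with (the Lipschitz extensions of $F$ satisfying) $$|F|_{\operatorname{Lip}(\ell_{2}(\mathbb{Z}; H))} < 1/M_1 \quad\text{and}\quad |F|_{\operatorname{Lip}(\ell_{2,\rho}(\mathbb{Z}; H))} < 1/M_\rho,$$ and assume $F$ is causal and $F(0) = 0$. Let $P \coloneqq P_1^+$, $Q \coloneqq P_1^-$ be the Riesz projections. For $\xi \in P[H]$ let $T(\xi)\in\ell_2(\mathbb{Z};H)$ be the unique fixed point of the contraction $w\mapsto \chi_{\mathbb{Z}_{\geq 0}}(\tau - A)^{-1}(F(w) + \delta_{-1}\xi)$ on $\ell_2(\mathbb{Z};H)$. For $x\in H$ let $\mathcal{S}_\rho(x)$ be the unique $u\in\ell_{2,\rho}(\mathbb{Z};H)$ with $\tau u = Au + F(u) + \delta_{-1}x$. Define $w^s\colon P[H]\to Q[H]$, $w^s(\xi) = Q\big(T(\xi)_0\big)$. Then the stable set $$W^s \coloneqq \{x \in H : \mathcal{S}_\rho(x) \in \ell_2(\mathbb{Z}; H)\}$$ satisfies $W^s = \{\xi + w^s(\xi) : \xi \in P[H]\}$.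
   Context: $H$ is a separable complex Hilbert space; $r(A)$ is the spectral radius; $S_\gamma=\{z\in\mathbb{C}:|z|=\gamma\}$. $A$ is hyperbolic if $\sigma(A)\cap S_1=\emptyset$. Riesz projections: $P_1^+ = \frac{1}{2\pi i}\int_{S_1}(z-A)^{-1}\,dz$ and $P_1^- = I - P_1^+$. For $\gamma>0$, $\ell_{2,\gamma}(\mathbb{Z}; H) = \{u\in H^{\mathbb{Z}} : \sum_k|u_k|_H^2\gamma^{-2k}<\infty\}$ with norm $(\sum_k|u_k|_H^2\gamma^{-2k})^{1/2}$, and $\ell_2=\ell_{2,1}$. $\operatorname{cc}(\mathbb{Z};H)$ is the space of sequences with finitely many nonzero entries. $F\colon\operatorname{cc}\to\ell_{2,\rho_1}\cap\ell_{2,\rho_2}$ is $(\rho_1,\rho_2)$-admissible if $F$ is Lipschitz as a map $\operatorname{cc}\subseteq\ell_{2,\rho_i}(\mathbb{Z};H)\to\ell_{2,\rho_i}(\mathbb{Z};H)$ for $i=1,2$; its unique Lipschitz extensions to $\ell_{2,\rho_i}(\mathbb{Z};H)$ are again denoted $F$. $F\colon\operatorname{cc}\to H^{\mathbb{Z}}$ is causal if for all $u,v\in\operatorname{cc}$ and $a\in\mathbb{Z}$, $\operatorname{spt}(u-v)\subseteq\mathbb{Z}_{\ge a}$ implies $\operatorname{spt}(F(u)-F(v))\subseteq\mathbb{Z}_{\ge a}$, where $\operatorname{spt} u = \{n:u_n\ne0\}$. $\tau$ is the shift $(\tau u)_n=u_{n+1}$, $A$ acts componentwise on sequences, $(\tau-A)^{-1}$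 is the inverse of $\tau-A$ on the relevant sequence space, $\delta_{-1}x$ has entry $x$ at index $-1$ and $0$ elsewhere, and $\chi_{\mathbb{Z}_{\ge0}}$ is multiplication by the indicator of $\mathbb{Z}_{\geq 0}$. *)

(* Defs.v *)
(* Scalars: C := R[i] (real_closed complex),
   R : realType.  The Hilbert space H is a complete normed R[i]-module V together
   with an inner product inducing its norm, assumed separable. *)
From HB Require Import structures.
From mathcomp Require Import all_boot all_order all_algebra.
From mathcomp Require Import all_classical all_reals all_analysis.
From mathcomp Require Import complex.
Import Order.TTheory GRing.Theory Num.Theory.
Import numFieldNormedType.Exports.
Local Open Scope ring_scope.
Local Open Scope classical_set_scope.

Set Implicit Arguments.
Unset Strict Implicit.
Unset Printing Implicit Defensive.

Section Defs.
Variable R : realType.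
Variable V : normedModType R[i].

(* real-valued norm on V (the norm of V takes values in R[i], on the real axis) *)
Definition nrm (x : V) : R := complex.Re `|x|.
Definition cabs (z : R[i]) : R := complex.Re `|z|.

Definition inner_product_of_norm (ip : V -> V -> R[i]) : Prop :=
  [/\ forall (a : R[i]) (x y w : V), ip (a *: x + y) w = a * ip x w + ip y w,
      forall x y : V, ip y x = (ip x y)^*
    & forall x : V, ip x x = `|x| ^+ 2].

Definition separable_space : Prop := exists D : nat -> V, dense (range D).

Definition bounded_linear (A : V -> V) : Prop :=
  [/\ forall (a : R[i]) (x y : V), A (a *: x + y) = a *: A x + A y
    & continuous A].

Definition in_spectrum (A : V -> V) (z : R[i]) : Prop :=
  ~ bijective (fun x : V => z *: x - A x).
Definition spectral_radius (A : V -> V) : R :=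
  sup [set r : R | exists z, in_spectrum A z /\ r = cabs z].
Definition hyperbolic (A : V -> V) : Prop :=
  forall z : R[i], cabs z = 1 -> ~ in_spectrum A z.

(* resolvent (z - A)^{-1} x  (meaningful for z outside the spectrum) *)
Definition resolvent (A : V -> V) (z : R[i]) (x : V) : V :=
  xget 0 [set y : V | z *: y - A y = x].

Definition resolvent_sup (A : V -> V) (gamma : R) : R :=
  sup [set r : R | exists (z : R[i]) (x : V),
         [/\ cabs z = gamma, nrm x <= 1 & r = nrm (resolvent A z x)]].

Definition root_unity (N k : nat) : R[i] :=
  (cos (2 * pi * k%:R / N%:R) +i* sin (2 * pi * k%:R / N%:R))%C.

(* Riemann sums of (1/(2 pi i)) \int_{S_1} (z - A)^{-1} x dz with z = e^{i theta}:
   (1/2pi) \int_0^{2pi} e^{i theta} (e^{i theta} - A)^{-1} x dtheta *)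
Definition riesz_sum (A : V -> V) (x : V) (N : nat) : V :=
  (N.+1%:R)^-1 *: \sum_(k < N.+1)
     (root_unity N.+1 k *: resolvent A (root_unity N.+1 k) x).

Definition riesz_plus (A : V -> V) (x : V) : V := lim (riesz_sum A x @ \oo).
Definition riesz_minus (A : V -> V) (x : V) : V := x - riesz_plus A x.

Definition wterm (gamma : R) (u : int -> V) (k : int) : R :=
  nrm (u k) ^+ 2 * gamma ^ (- (2 * k)).
(* the sum over Z, arranged as k = n and k = -(n+1) for n : nat *)
Definition wterm_nat (gamma : R) (u : int -> V) (n : nat) : R :=
  wterm gamma u (n%:Z) + wterm gamma u (Negz n).
Definition in_l2w (gamma : R) (u : int -> V) : Prop :=
  cvg (series (wterm_nat gamma u) @ \oo).
Definition l2w_norm (gamma : R) (u : int -> V) : R :=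
  Num.sqrt (lim (series (wterm_nat gamma u) @ \oo)).

Definition in_cc (u : int -> V) : Prop :=
  exists N : nat, forall k : int, (N%:Z < `|k|)%R -> u k = 0.

Definition seq_sub (u v : int -> V) : int -> V := fun k => u k - v k.

Definition lipschitz_on_l2w (gamma : R) (D : set (int -> V))
    (G : (int -> V) -> (int -> V)) (L : R) : Prop :=
  forall u v, D u -> D v ->
    l2w_norm gamma (seq_sub (G u) (G v)) <= L * l2w_norm gamma (seq_sub u v).

Definition admissible (rho1 rho2 : R) (F : (int -> V) -> (int -> V)) : Prop :=
  [/\ forall u, in_cc u -> in_l2w rho1 (F u) /\ in_l2w rho2 (F u),
      exists L, lipschitz_on_l2w rho1 in_cc F L
    & exists L, lipschitz_on_l2w rho2 in_cc F L].

Definition lipschitz_extension (gamma : R) (F G : (int -> V) -> (int -> V))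
    (L : R) : Prop :=
  [/\ forall u, in_l2w gamma u -> in_l2w gamma (G u),
      forall u, in_cc u -> G u = F u,
      0 <= L
    & lipschitz_on_l2w gamma (in_l2w gamma) G L].

Definition causal (F : (int -> V) -> (int -> V)) : Prop :=
  forall (u v : int -> V) (a : int), in_cc u -> in_cc v ->
    (forall k, (k < a)%R -> u k = v k) ->
    (forall k, (k < a)%R -> F u k = F v k).

Definition delta_m1 (x : V) : int -> V := fun k => if k == (-1)%R then x else 0.
Definition chi_nonneg (g : int -> V) : int -> V :=
  fun k => if (0 <= k)%R then g k else 0.

(* w is a fixed point (in l_2) of  w |-> chi_{Z>=0} (tau - A)^{-1} (G w + delta_{-1} xi),
   where (tau - A)^{-1} is the inverse of tau - A on l_2 *)
Definition T_fixed_point (A : V -> V) (G : (int -> V) -> (int -> V))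
    (xi : V) (w : int -> V) : Prop :=
  in_l2w 1 w /\
  exists g : int -> V, [/\ in_l2w 1 g,
     forall k, g (k + 1)%R - A (g k) = G w k + delta_m1 xi k
   & w = chi_nonneg g].

Definition S_solution (A : V -> V) (G : (int -> V) -> (int -> V)) (rho : R)
    (x : V) (u : int -> V) : Prop :=
  in_l2w rho u /\ forall k, u (k + 1)%R = A (u k) + G u k + delta_m1 x k.

End Defs.

(* Main.v *)
Require Import Defs.
From HB Require Import structures.
From mathcomp Require Import all_boot all_order all_algebra.
From mathcomp Require Import all_classical all_reals all_analysis.
From mathcomp Require Import complex.
From mathcomp Require Import ring lra zify.
Import Order.TTheory GRing.Theory Num.Theory.
Import numFieldNormedType.Exports.
Local Open Scope ring_scope.
Local Open Scope classical_set_scope.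

Set Implicit Arguments.
Unset Strict Implicit.
Unset Printing Implicit Defensive.

(** Write [(tau u)_k = u_(k+1)]. Everything rests on the a priori bound
    [|u| <= M |(tau - A) u|] in the weighted space of weight [gamma], where [M] bounds the
    resolvent of [A] on the circle of radius [gamma]: for a finitely supported [u] it is
    Parseval's identity on a cyclic group [Z/N] with [N] large, and truncation extends it to all
    square summable [u]. The sums defining the Riesz projection generate [N]-periodic solutions
    of [(tau - A) h = delta x]; cut where they are small, these become approximate solutions in
    [l_2], Cauchy by the a priori bound, so [tau - A] is onto and [P x] is the entry at [0] of
    the Green function of [x]. On the weight [rho] the Green function is the forward orbit of
    [x], since the powers of [A] are bounded by those of some [t < rho].
    Hence both fixed point problems are contractions. A solution [u] of the initial value problem
    that lies in [l_2] is supported on [k >= 0] and subtracting the Green function of [Q x]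
    exhibits it as [T (P x)]. Conversely, if [w = T xi] comes from [g], then [g] is a
    backward orbit on [k < 0], so [P g_0 = xi] and [w] solves the initial value problem
    started at [xi + Q w_0]. *)

(** * Real-valued norms *)

Section RealNorm.
Variables (R : realType) (V : normedModType R[i]).
Implicit Types (x y : V) (a z : R[i]).

Lemma nrm_complex x : (nrm x)%:C%C = `|x|.
Proof. by rewrite /nrm RRe_real // normr_real. Qed.

Lemma cabs_complex z : (cabs z)%:C%C = `|z|.
Proof. by rewrite /cabs RRe_real // normr_real. Qed.

Lemma nrm_ge0 x : 0 <= nrm x.
Proof. by rewrite -ler0c nrm_complex. Qed.

Lemma nrm0 : nrm (0 : V) = 0.
Proof. by rewrite /nrm normr0. Qed.

Lemma nrm_eq0 x : nrm x = 0 -> x = 0.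
Proof. by move=> h; apply/eqP; rewrite -normr_eq0 -nrm_complex h. Qed.

Lemma nrm_gt0 x : x != 0 -> 0 < nrm x.
Proof. by move=> x0; rewrite -ltcR nrm_complex normr_gt0. Qed.

Lemma nrmN x : nrm (- x) = nrm x.
Proof. by rewrite /nrm normrN. Qed.

Lemma nrm_distC x y : nrm (x - y) = nrm (y - x).
Proof. by rewrite /nrm distrC. Qed.

Lemma nrmD x y : nrm (x + y) <= nrm x + nrm y.
Proof. by rewrite -lecR rmorphD /= !nrm_complex ler_normD. Qed.

Lemma nrmB x y : nrm (x - y) <= nrm x + nrm y.
Proof. by rewrite -(nrmN y) nrmD. Qed.

Lemma nrm_triangle x y w : nrm (x - w) <= nrm (x - y) + nrm (y - w).
Proof.
have -> : x - w = (x - y) + (y - w) by rewrite addrA subrK.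
exact: nrmD.
Qed.

Lemma nrmZ a x : nrm (a *: x) = cabs a * nrm x.
Proof. by apply: complexI; rewrite rmorphM /= !nrm_complex cabs_complex normrZ. Qed.

Lemma cabsD a z : cabs (a + z) <= cabs a + cabs z.
Proof. by rewrite -lecR rmorphD /= !cabs_complex ler_normD. Qed.

Lemma cabsM a z : cabs (a * z) = cabs a * cabs z.
Proof. by apply: complexI; rewrite rmorphM /= !cabs_complex normrM. Qed.

Lemma cabs_real (r : R) : cabs r%:C%C = `|r|.
Proof. by rewrite /cabs normc_def /= expr0n /= addr0 sqrtr_sqr. Qed.

Lemma cabs_pos (r : R) : 0 <= r -> cabs r%:C%C = r.
Proof. by move=> r0; rewrite cabs_real ger0_norm. Qed.

Lemma nrmZr (r : R) x : 0 <= r -> nrm (r%:C%C *: x) = r * nrm x.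
Proof. by move=> r0; rewrite nrmZ cabs_pos. Qed.

Lemma cabsV z : cabs z^-1 = (cabs z)^-1.
Proof. by apply: complexI; rewrite fmorphV /= !cabs_complex normfV. Qed.

Lemma cabsE z : cabs z = Num.sqrt (complex.Re z ^+ 2 + complex.Im z ^+ 2).
Proof. by rewrite /cabs normc_def. Qed.

(** Convergence with real tolerances. [vconvP] identifies it with the library notion, whose
    tolerances are positive elements of [R[i]]. *)
Definition vconv (u : nat -> V) (l : V) :=
  forall e : R, 0 < e -> exists N, forall n, (N <= n)%N -> nrm (u n - l) <= e.

(** The order of [R[i]] compares only numbers with equal imaginary parts, so a positive element is
    real. *)
Lemma posC (e : R[i]) : 0 < e -> 0 < complex.Re e /\ e = (complex.Re e)%:C%C.
Proof. by case: e => a b; rewrite ltcE /= => /andP[/eqP -> ->]. Qed.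

Lemma vconvP u l : vconv u l <-> u @ \oo --> l.
Proof.
split=> [h|/cvgrPdist_le h e e0].
  apply/cvgrPdist_le => e /posC[e0 ->]; have [N hN] := h _ e0.
  by exists N => // n /= Nn; rewrite -nrm_complex lecR nrm_distC hN.
have [|N _ hN] := h e%:C%C; first by rewrite ltcR.
by exists N => n /hN /=; rewrite -nrm_complex lecR nrm_distC.
Qed.

Lemma vconv_lim u l : vconv u l -> lim (u @ \oo) = l.
Proof. by move/vconvP => h; apply/cvg_lim. Qed.

Lemma nrm_le0 x : (forall e : R, 0 < e -> nrm x <= e) -> x = 0.
Proof.
move=> h; apply/nrm_eq0/eqP; rewrite eq_le nrm_ge0 andbT.
by apply/ler_addgt0Pr => e /h; rewrite add0r.
Qed.

Lemma vconv_unique u l m : vconv u l -> vconv u m -> l = m.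
Proof. by move=> h k; rewrite -(vconv_lim h) (vconv_lim k). Qed.

Lemma vconvD u v l m : vconv u l -> vconv v m -> vconv (fun n => u n + v n) (l + m).
Proof. by move=> /vconvP h /vconvP k; apply/vconvP; exact: cvgD h k. Qed.

Lemma vconvB u v l m : vconv u l -> vconv v m -> vconv (fun n => u n - v n) (l - m).
Proof. by move=> /vconvP h /vconvP k; apply/vconvP; exact: cvgB h k. Qed.

Lemma vconv_cst x : vconv (fun=> x) x.
Proof. by apply/vconvP; exact: cvg_cst. Qed.

Lemma vconv_bounded_linear (B : {linear V -> V}) (C : R) u l :
  (forall x, nrm (B x) <= C * nrm x) -> vconv u l ->
  vconv (fun n => B (u n)) (B l).
Proof.
(* [C] has no prescribed sign; [|C| + 1] is a positive bound that can be divided by. *)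
move=> hB h e e0; have C0 : 0 < `|C| + 1 by rewrite ltr_wpDl.
have [N hN] := h (e / (`|C| + 1)) (divr_gt0 e0 C0).
exists N => n /hN h1; rewrite -linearB (le_trans (hB _)) //.
rewrite (@le_trans _ _ ((`|C| + 1) * nrm (u n - l))) //.
  by rewrite ler_wpM2r ?nrm_ge0 // (le_trans (ler_norm _)) // lerDl.
by rewrite mulrC -ler_pdivlMr.
Qed.

End RealNorm.

Section Complete.
Variables (R : realType) (V : completeNormedModType R[i]).

Lemma vconv_cauchy (u : nat -> V) :
  (forall e : R, 0 < e -> exists N, forall m n, (N <= m)%N -> (N <= n)%N ->
     nrm (u m - u n) <= e) ->
  exists l, vconv u l.
Proof.
move=> h; have : cvg (u @ \oo).
  apply: cauchy_cvg; apply/cauchy_ballP => e /posC[e0 ee].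
  have [N hN] := h _ (divr_gt0 e0 (ltr0n _ 2)).
  exists (u @` [set n | (N <= n)%N], u @` [set n | (N <= n)%N]) => /=.
    by split; exists N => // n /= Nn; exists n.
  move=> [_ _] /= [[m Nm <-] [n Nn <-]].
  rewrite -ball_normE /ball_ /= ee -nrm_complex ltcR (le_lt_trans (hN _ _ Nm Nn)) //.
  by rewrite ltr_pdivrMr // ltr_pMr // ltr1n.
by move=> /cvg_ex[l /vconvP]; exists l.
Qed.

End Complete.

Lemma NegzS_succ n : Negz n.+1 + 1 = Negz n.
Proof. by lia. Qed.

(** * Weighted square summable sequences *)

Section Sequences.
Variables (R : realType) (V : normedModType R[i]).

Definition delta (m : int) (x : V) : int -> V := fun k => if k == m then x else 0.

(** The window is half-open because the [n]-th partial sum of [wterm_nat] runs over exactly these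
    indices: it pairs [k] with [-(k + 1)]. *)
Definition trunc (n : nat) (u : int -> V) : int -> V := fun k => if (- n%:Z <= k < n%:Z) then u k else 0.

Lemma in_cc_trunc n u : in_cc (trunc n u).
Proof. by exists n => k hk; rewrite /trunc ifF //; apply/negbTE; lia. Qed.

End Sequences.

Section WeightedL2.
Variables (R : realType) (V : normedModType R[i]) (gamma : R).
Hypothesis gamma_gt0 : 0 < gamma.
Implicit Types (u v : int -> V) (a b k m : int) (c : R) (x : V).

(** Energy on the window [a <= k < a + n]. Finite windows replace the two-sided series in all
    estimates. *)
Definition en u (a : int) (n : nat) : R := \sum_(i < n) wterm gamma u (a + i%:Z).

(** The bound [|u| <= c] tested on every finite window, so that it makes sense before [u] is known
    to be summable. Only [c ^+ 2] enters, whence the side conditions [0 <= c] below. *)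
Definition l2bd u c := forall a n, en u a n <= c ^+ 2.

Lemma wterm_ge0 u k : 0 <= wterm gamma u k.
Proof. by rewrite mulr_ge0 ?sqr_ge0 // exprz_ge0 // ltW. Qed.

Lemma en_ge0 u a n : 0 <= en u a n.
Proof. by apply: sumr_ge0 => i _; apply: wterm_ge0. Qed.

Lemma en_cat u a (m n : nat) : en u a (m + n) = en u a m + en u (a + m%:Z) n.
Proof.
rewrite /en big_split_ord /=; congr (_ + _); apply: eq_bigr => i _.
by rewrite -addrA PoszD.
Qed.

Lemma en1 u a : en u a 1 = wterm gamma u a.
Proof. by rewrite /en big_ord1 addr0. Qed.

Lemma en_zero u a n : (forall k, a <= k < a + n%:Z -> u k = 0) -> en u a n = 0.
Proof.
move=> h; apply: big1 => i _; rewrite /wterm h ?nrm0 ?expr0n ?mul0r //.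
by have := ltn_ord i; lia.
Qed.

Lemma en_mono u a (n : nat) b (m : nat) : b <= a -> a + n%:Z <= b + m%:Z -> en u a n <= en u b m.
Proof.
move=> ba h.
have [p ap] : exists p : nat, a = b + p%:Z by exists (`|a - b|%N); lia.
have [q ->] : exists q : nat, m = (p + (n + q))%N by exists (m - (p + n))%N; lia.
by rewrite en_cat -ap en_cat addrCA lerDl addr_ge0 ?en_ge0.
Qed.

(** Both windows lie in the symmetric window of radius [K], whose energy equals that of the window
    carrying the support. *)
Lemma en_supp u a (n : nat) b (m : nat) :
  (forall k, (k < b) || (b + m%:Z <= k) -> u k = 0) -> en u a n <= en u b m.
Proof.
move=> h; pose K := (absz a + absz b + n + m)%N.
have -> : en u b m = en u (- K%:Z) (K + K).
  have [p bp] : exists p : nat, b = - K%:Z + p%:Z by exists (absz (b + K%:Z)); rewrite /K; lia.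
  have [q ->] : exists q : nat, (K + K = p + (m + q))%N.
    by exists (K + K - (p + m))%N; rewrite /K in bp *; lia.
  rewrite en_cat -bp en_cat.
  rewrite (@en_zero u (- K%:Z) p) ?(@en_zero u (b + m%:Z) q) ?add0r ?addr0 // => k hk.
    by apply: h; lia.
  by apply: h; lia.
by apply: en_mono; rewrite /K; lia.
Qed.

Lemma series_en u n : series (wterm_nat gamma u) n = en u (- n%:Z) (n + n).
Proof.
elim: n => [|n IH]; first by rewrite /series /= big_geq // /en big_ord0.
have -> : series (wterm_nat gamma u) n.+1 = series (wterm_nat gamma u) n + wterm_nat gamma u n.
  by rewrite /series /= big_nat_recr.
rewrite IH.
have -> : (n.+1 + n.+1 = 1 + ((n + n) + 1))%N by lia.
rewrite (en_cat _ _ 1%N) (en_cat _ _ (n + n)%N 1%N) !en1 /wterm_nat.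
have -> : - n.+1%:Z + 1%:Z = - n%:Z by lia.
have -> : - n%:Z + (n + n)%N%:Z = n%:Z by lia.
have -> : Negz n = - n.+1%:Z by lia.
by ring.
Qed.

Lemma l2bd_sym u c :
  (forall K : nat, exists2 K', (K <= K')%N & en u (- K'%:Z) (K' + K') <= c ^+ 2) ->
  l2bd u c.
Proof.
move=> h a n; have [K' KK] := h (absz a + n)%N.
by apply: le_trans; apply: en_mono; lia.
Qed.

Lemma series_wterm_nd u : nondecreasing_seq (series (wterm_nat gamma u)).
Proof.
apply/nondecreasing_seqP => n; rewrite !series_en.
by apply: en_mono; lia.
Qed.

Lemma l2bd_norm u : in_l2w gamma u -> l2bd u (l2w_norm gamma u).
Proof.
move=> hu; have le n : series (wterm_nat gamma u) n <= lim (series (wterm_nat gamma u) @ \oo).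
  by apply: nondecreasing_cvgn_le => //; exact: series_wterm_nd.
apply: l2bd_sym => K; exists K => //; rewrite -series_en /l2w_norm sqr_sqrtr //.
by apply: le_trans (le 0%N); rewrite series_en en_ge0.
Qed.

Lemma l2w_norm_ge0 u : 0 <= l2w_norm gamma u.
Proof. exact: sqrtr_ge0. Qed.

Lemma l2bd_in u c : l2bd u c -> in_l2w gamma u.
Proof.
move=> h; apply: nondecreasing_is_cvgn; first exact: series_wterm_nd.
by exists (c ^+ 2) => _ [n _ <-]; rewrite series_en h.
Qed.

Lemma l2w_norm_le u c : 0 <= c -> l2bd u c -> l2w_norm gamma u <= c.
Proof.
move=> c0 h; rewrite -[c]ger0_norm // -sqrtr_sqr /l2w_norm ler_wsqrtr //.
apply: limr_le; first exact: l2bd_in h.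
by apply: nearW => n; rewrite series_en h.
Qed.

Lemma l2bd_le u c d : 0 <= c -> c <= d -> l2bd u c -> l2bd u d.
Proof.
move=> c0 cd h a n; apply: le_trans (h a n) _.
by rewrite ler_pXn2r // nnegrE (le_trans c0).
Qed.

Lemma l2bd_closed u c : 0 <= c -> (forall e, 0 < e -> l2bd u (c + e)) -> l2bd u c.
Proof.
move=> c0 h a n; rewrite -[en u a n]sqr_sqrtr ?en_ge0 // ler_pXn2r // ?nnegrE ?sqrtr_ge0 //.
apply/ler_addgt0Pr => e e0; rewrite -[c + e]ger0_norm ?addr_ge0 ?(ltW e0) // -sqrtr_sqr.
by rewrite ler_wsqrtr // h.
Qed.

Lemma l2bd_dom u v C c : 0 <= C -> (forall k, nrm (u k) <= C * nrm (v k)) ->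
  l2bd v c -> l2bd u (C * c).
Proof.
move=> C0 huv hv a n; rewrite exprMn; apply: (@le_trans _ _ (C ^+ 2 * en v a n)).
  rewrite /en mulr_sumr; apply: ler_sum => i _; rewrite /wterm mulrA -exprMn.
  rewrite ler_wpM2r ?exprz_ge0 ?(ltW gamma_gt0) //.
  by rewrite ler_pXn2r // nnegrE ?mulr_ge0 ?nrm_ge0.
by rewrite ler_wpM2l ?sqr_ge0.
Qed.

Lemma l2bd_ext u v c : (forall k, u k = v k) -> l2bd v c -> l2bd u c.
Proof. by move=> /funext ->. Qed.

Lemma l2bdN u v c : l2bd (fun k => u k - v k) c -> l2bd (fun k => v k - u k) c.
Proof.
by move=> h; rewrite -[c]mul1r; apply: l2bd_dom h => // k; rewrite mul1r nrm_distC.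
Qed.

(** Minkowski's inequality. Termwise [(p + q)^2 <= (1 + t/s) p^2 + (1 + s/t) q^2], and with the
    bounds [s], [t] themselves as parameters the sum is exactly [(s + t)^2]. Zero bounds are reached
    by adding [e / 2] to each. *)
Lemma l2bdD u v s t : 0 <= s -> 0 <= t -> l2bd u s -> l2bd v t ->
  l2bd (fun k => u k + v k) (s + t).
Proof.
have main : forall s t, 0 < s -> 0 < t -> l2bd u s -> l2bd v t ->
    l2bd (fun k => u k + v k) (s + t).
  move=> {}s {}t s0 t0 hu hv a n.
  have H : en (fun k => u k + v k) a n <= (1 + t / s) * en u a n + (1 + s / t) * en v a n.
    rewrite /en !mulr_sumr -big_split; apply: ler_sum => i _ /=.
    rewrite /wterm [X in _ <= X + _]mulrA [X in _ <= _ + X]mulrA -mulrDl ler_wpM2r ?exprz_ge0 ?(ltW gamma_gt0) //.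
    set p := nrm (u _); set q := nrm (v _).
    have p0 : 0 <= p by apply: nrm_ge0.
    have q0 : 0 <= q by apply: nrm_ge0.
    apply: (@le_trans _ _ ((p + q) ^+ 2)).
      by rewrite ler_pXn2r ?nnegrE ?nrm_ge0 ?addr_ge0 // nrmD.
    rewrite -subr_ge0; have -> : (1 + t / s) * p ^+ 2 + (1 + s / t) * q ^+ 2 - (p + q) ^+ 2
      = (t * p - s * q) ^+ 2 / (s * t) by field; rewrite ?gt_eqF.
    by rewrite divr_ge0 ?sqr_ge0 ?mulr_ge0 // ltW.
  apply: (le_trans H); have -> : (s + t) ^+ 2 = (1 + t / s) * s ^+ 2 + (1 + s / t) * t ^+ 2.
    by field; rewrite ?gt_eqF.
  by rewrite lerD // ler_wpM2l // addr_ge0 // divr_ge0 // ltW.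
move=> s0 t0 hu hv; apply: l2bd_closed => [|e e0]; first exact: addr_ge0.
have e2 : 0 < e / 2 by rewrite divr_gt0.
have -> : s + t + e = (s + e / 2) + (t + e / 2) by field.
apply: main; rewrite ?ltr_wpDl //.
- by apply: l2bd_le hu; rewrite ?lerDl ?(ltW e2).
- by apply: l2bd_le hv; rewrite ?lerDl ?(ltW e2).
Qed.

Lemma l2bdB u v s t : 0 <= s -> 0 <= t -> l2bd u s -> l2bd v t ->
  l2bd (fun k => u k - v k) (s + t).
Proof.
move=> s0 t0 hu hv; apply: (@l2bdD _ (fun k => - v k)) => //.
by rewrite -[t]mul1r; apply: l2bd_dom hv => // k; rewrite mul1r nrmN.
Qed.

Lemma l2bd_shift u c (j : int) : l2bd u c -> l2bd (fun k => u (k + j)) (gamma ^ j * c).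
Proof.
move=> h a n; have -> : en (fun k => u (k + j)) a n = (gamma ^ j) ^+ 2 * en u (a + j) n.
  rewrite /en mulr_sumr; apply: eq_bigr => i _; rewrite /wterm -addrA [i%:Z + j]addrC addrA.
  rewrite mulrCA; congr (_ * _); rewrite -[_ ^+ 2]/(gamma ^ j * gamma ^ j).
  by rewrite -!expfzDr ?gt_eqF //; congr (_ ^ _); lia.
by rewrite exprMn ler_wpM2l ?sqr_ge0.
Qed.

Lemma exprz_sqr k : (gamma ^ k) ^+ 2 = gamma ^ (2 * k).
Proof. by rewrite exprnP exprz_exp mulrC. Qed.

Lemma l2bd_point u c k : 0 <= c -> l2bd u c -> nrm (u k) <= c * gamma ^ k.
Proof.
move=> c0 /(_ k 1%N); rewrite en1 /wterm => h.
have g0 : 0 < gamma ^ k by rewrite exprz_gt0.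
rewrite -ler_pdivrMr // -[_ / _]ger0_norm ?divr_ge0 ?nrm_ge0 ?(ltW g0) //.
rewrite -[c]ger0_norm // -!sqrtr_sqr ler_wsqrtr // expr_div_n.
by rewrite exprz_sqr invr_expz.
Qed.

Lemma l2bd0 : l2bd (fun=> 0) 0.
Proof. by move=> a n; rewrite en_zero ?expr0n. Qed.

Lemma l2bd_le0 u k : l2bd u 0 -> u k = 0.
Proof.
move=> h; apply: nrm_le0 => e e0.
by apply: le_trans (l2bd_point k _ h) _; rewrite ?mul0r ?(ltW e0).
Qed.

Lemma in_l2wP u : in_l2w gamma u <-> exists2 c, 0 <= c & l2bd u c.
Proof.
split=> [hu|[c _ /l2bd_in //]].
by exists (l2w_norm gamma u); [exact: l2w_norm_ge0|exact: l2bd_norm].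
Qed.

Lemma in_l2wD u v : in_l2w gamma u -> in_l2w gamma v -> in_l2w gamma (fun k => u k + v k).
Proof.
move=> /in_l2wP[c c0 hc] /in_l2wP[d d0 hd]; apply/in_l2wP; exists (c + d).
  exact: addr_ge0.
exact: l2bdD.
Qed.

Lemma in_l2wB u v : in_l2w gamma u -> in_l2w gamma v -> in_l2w gamma (fun k => u k - v k).
Proof.
move=> /in_l2wP[c c0 hc] /in_l2wP[d d0 hd]; apply/in_l2wP; exists (c + d).
  exact: addr_ge0.
exact: l2bdB.
Qed.

Lemma in_l2w_dom u v C : 0 <= C -> (forall k, nrm (u k) <= C * nrm (v k)) ->
  in_l2w gamma v -> in_l2w gamma u.
Proof.
move=> C0 h /in_l2wP[c c0 hc]; apply/in_l2wP; exists (C * c); rewrite ?mulr_ge0 //.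
exact: l2bd_dom hc.
Qed.

Lemma in_l2w_shift u (j : int) : in_l2w gamma u -> in_l2w gamma (fun k => u (k + j)).
Proof. by move=> /in_l2wP[c c0 hc]; apply: l2bd_in (l2bd_shift j hc). Qed.

Lemma l2bd_delta m x : l2bd (delta m x) (nrm x * gamma ^ (- m)).
Proof.
move=> a n; apply: le_trans (@en_supp _ _ _ m 1 _) _.
  by move=> k hk; rewrite /delta; case: eqP => // km; lia.
by rewrite en1 /wterm /delta eqxx exprMn exprz_sqr mulrN.
Qed.

Lemma in_l2w_delta m x : in_l2w gamma (delta m x).
Proof. exact: l2bd_in (l2bd_delta m x). Qed.

Lemma in_l2w_cc u : in_cc u -> in_l2w gamma u.
Proof.
move=> [N hN]; apply: (@l2bd_in _ (Num.sqrt (en u (- N%:Z) (N + N + 1)))) => a n.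
rewrite sqr_sqrtr ?en_ge0 //; apply: en_supp => k hk; apply: hN.
by lia.
Qed.

(** On a large window the energy of [u] is that of the truncation plus that of the tail. The total
    is at most the limit of the series and the truncation accounts for at least the [n]-th partial
    sum, so the tail is bounded by the remainder. *)
Lemma l2bd_trunc u : in_l2w gamma u ->
  forall e, 0 < e -> exists N, forall n, (N <= n)%N -> l2bd (fun k => u k - trunc n u k) e.
Proof.
move=> hu e e0; set l := lim (series (wterm_nat gamma u) @ \oo).
have le n : series (wterm_nat gamma u) n <= l.
  by apply: nondecreasing_cvgn_le => //; exact: series_wterm_nd.
have : series (wterm_nat gamma u) @ \oo --> l by [].
move/cvgrPdist_le => /(_ (e ^+ 2)) []; first by rewrite exprn_gt0.
move=> N _ hN; exists N => n Nn; apply: l2bd_sym => K.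
exists (K + n)%N; rewrite ?leq_addr //.
have := hN n Nn; rewrite /= ger0_norm ?subr_ge0 //.
set K' := (K + n)%N.
have eqn : en u (- K'%:Z) (K' + K') =
    en (fun k => u k - trunc n u k) (- K'%:Z) (K' + K') + en (trunc n u) (- K'%:Z) (K' + K').
  rewrite /en -big_split; apply: eq_bigr => i _ /=; rewrite /wterm /trunc.
  by case: ifP => _; rewrite ?subrr ?subr0 nrm0 expr0n mul0r ?addr0 ?add0r.
have h1 : en u (- n%:Z) (n + n) <= en (trunc n u) (- K'%:Z) (K' + K').
  apply: le_trans (_ : en (trunc n u) (- n%:Z) (n + n) <= _).
    rewrite le_eqVlt; apply/orP; left; apply/eqP; apply: eq_bigr => i _.
    by rewrite /wterm /trunc ifT //; have := ltn_ord i; lia.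
  by apply: en_mono; rewrite /K'; lia.
have := le K'; rewrite !series_en eqn; lra.
Qed.

Definition l2conv (u_ : nat -> int -> V) u :=
  forall e, 0 < e -> exists N, forall n, (N <= n)%N -> l2bd (fun k => u_ n k - u k) e.

Lemma l2conv_point (u_ : nat -> int -> V) u k : l2conv u_ u -> vconv (fun n => u_ n k) (u k).
Proof.
move=> h e e0; have g0 : 0 < gamma ^ k by rewrite exprz_gt0.
have [N hN] := h (e / gamma ^ k) (divr_gt0 e0 g0); exists N => n /hN h1.
apply: le_trans (l2bd_point k _ h1) _; first by rewrite divr_ge0 ?ltW.
by rewrite divfK // gt_eqF.
Qed.

(** Fatou on finite windows: a finite sum is continuous under entrywise convergence, so an eventual
    bound passes to the limit. *)
Lemma en_lim (u_ : nat -> int -> V) u c a n : 0 <= c ->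
  (forall k, vconv (fun p => u_ p k) (u k)) ->
  (exists N, forall p, (N <= p)%N -> l2bd (u_ p) c) -> en u a n <= c ^+ 2.
Proof.
move=> c0 hc [N hN].
have h : forall k, (fun p => wterm gamma (u_ p) k) @ \oo --> wterm gamma u k.
  move=> k; rewrite /wterm; apply: cvgMl; rewrite -[X in _ --> X]/(nrm (u k) * nrm (u k)).
  have hk : (fun p => nrm (u_ p k)) @ \oo --> nrm (u k).
    apply/cvgrPdist_le => e e0; have [M hM] := hc k e e0.
    exists M => // p /= /hM hp; apply: le_trans hp; rewrite ler_norml.
    have := nrm_triangle (u_ p k) (u k) 0; have := nrm_triangle (u k) (u_ p k) 0.
    by rewrite !subr0 [nrm (u k - _)]nrm_distC; lra.
  exact: (cvgM hk hk).
have hs : (fun p => en (u_ p) a n) @ \oo --> en u a n.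
  rewrite /en; elim: n => [|n IH].
    rewrite big_ord0 (_ : (fun=> _) = fun=> 0); first exact: cvg_cst.
    by apply/funext => p; rewrite big_ord0.
  rewrite big_ord_recr /= (_ : (fun=> _) =
    fun p => \sum_(i < n) wterm gamma (u_ p) (a + i) + wterm gamma (u_ p) (a + n)).
    exact: (cvgD IH (h _)).
  by apply/funext => p; rewrite big_ord_recr.
have <- : lim ((fun p => en (u_ p) a n) @ \oo) = en u a n by apply/cvg_lim.
by apply: limr_le; [apply/cvg_ex; exists (en u a n)|exists N => // p /= /hN].
Qed.

End WeightedL2.

(** * Completeness of the weighted spaces *)

Section Completeness.
Variables (R : realType) (V : completeNormedModType R[i]) (gamma : R).
Hypothesis gamma_gt0 : 0 < gamma.

(** The limit is taken entry by entry; letting one index of the Cauchy bound tend to infinity,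
    window by window, gives convergence in norm. *)
Lemma l2_complete (u_ : nat -> int -> V) :
  (forall n, in_l2w gamma (u_ n)) ->
  (forall e : R, 0 < e -> exists N, forall m n, (N <= m)%N -> (N <= n)%N ->
     l2bd gamma (fun k => u_ m k - u_ n k) e) ->
  exists2 u, in_l2w gamma u & l2conv gamma u_ u.
Proof.
move=> hin hC.
have /choice[u hu] : forall k, exists l, vconv (fun n => u_ n k) l.
  move=> k; apply: vconv_cauchy => e e0; have g0 : 0 < gamma ^ k by rewrite exprz_gt0.
  have [N hN] := hC (e / gamma ^ k) (divr_gt0 e0 g0); exists N => m n Nm Nn.
  apply: le_trans (l2bd_point gamma_gt0 k _ (hN m n Nm Nn)) _; first by rewrite divr_ge0 ?ltW.
  by rewrite divfK // gt_eqF.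
have cv : l2conv gamma u_ u.
  move=> e e0; have [N hN] := hC e e0; exists N => n Nn; apply: l2bdN => // a m.
  apply: (@en_lim _ _ gamma (fun p k => u_ p k - u_ n k) (fun k => u k - u_ n k)); rewrite ?(ltW e0) //.
    move=> k; apply: (@vconvD _ _ _ (fun=> - u_ n k)) => //; exact: vconv_cst.
  by exists N => p Np; apply: hN.
exists u => //; have [N hN] := cv 1 ltr01.
have -> : u = (fun k => u_ N k - (u_ N k - u k)) by apply/funext => k; rewrite subKr.
by apply: in_l2wB => //; apply: l2bd_in (hN N (leqnn N)).
Qed.

End Completeness.

(** * Parseval's identity on cyclic groups *)

Section RootsOfUnity.
Variables (R : realType).

Definition cis (t : R) : R[i] := (cos t +i* sin t)%C.

Lemma cisD s t : cis (s + t) = cis s * cis t.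
Proof.
rewrite /cis cosD sinD; apply/eqP; rewrite eq_complex /=; apply/andP; split; apply/eqP; ring.
Qed.

Lemma cis0 : cis 0 = 1.
Proof. by rewrite /cis cos0 sin0. Qed.

Lemma cisX t n : cis t ^+ n = cis (t * n%:R).
Proof.
elim: n => [|n IH]; first by rewrite mulr0 cis0 expr0.
by rewrite exprS IH -cisD; congr cis; rewrite -[in RHS]natr1 mulrDr mulr1 addrC.
Qed.

Lemma cabs_cis t : cabs (cis t) = 1.
Proof. by rewrite cabsE /= cos2Dsin2 sqrtr1. Qed.

Lemma root_unityE N k : root_unity R N k = cis (2 * pi / N%:R) ^+ k.
Proof.
rewrite cisX /root_unity /cis.
by have -> : 2 * pi * k%:R / N%:R = 2 * pi / N%:R * k%:R :> R by ring.
Qed.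

Lemma cabs_root_unity N k : cabs (root_unity R N k) = 1.
Proof. by rewrite root_unityE cisX cabs_cis. Qed.

Lemma cis_neq1 t : 0 < t < 2 * pi -> cis t != 1.
Proof.
move=> /andP[t0 t1]; rewrite /cis eq_complex /= negb_and; apply/orP; left.
(* [cos t = 1 - 2 sin^2 (t / 2)], and [t / 2] lies strictly between [0] and [pi]. *)
have s0 : 0 < sin (t / 2) by apply: sin_gt0_pi; lra.
have -> : t = (t / 2) *+ 2 by rewrite -mulr_natr divfK.
rewrite cos_mulr2n cos2sin2; set s := sin _ in s0 *.
by have := mulr_gt0 s0 s0; apply: contraTneq; nra.
Qed.

Lemma prim_cis N : (0 < N)%N -> N.-primitive_root (cis (2 * pi / N%:R)).
Proof.
move=> N0; have NR : 0 < N%:R :> R by rewrite ltr0n.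
rewrite /primitive_root_of_unity N0 /=; apply/forallP => i.
rewrite unity_rootE cisX; apply/eqP.
have := ltn_ord i; rewrite leq_eqVlt => /orP[/eqP ->|lt].
  have N1 : N%:R != 0 :> R by rewrite pnatr_eq0 -lt0n.
  by rewrite (divfK N1) mulr_natl /cis cos2pi sin2pi !eqxx.
rewrite (ltn_eqF lt); apply/negbTE/cis_neq1.
rewrite mulr_gt0 ?divr_gt0 ?mulr_gt0 ?pi_gt0 ?ltr0n //=.
rewrite mulrAC ltr_pdivrMr // ltr_pM2l ?mulr_gt0 ?pi_gt0 //.
by rewrite ltr_nat.
Qed.

(** A geometric sum with ratio [w ^+ m]: if [N] does not divide [m] the ratio differs from [1] while
    its [N]-th power is [1], so the sum vanishes. *)
Lemma sum_root_unity N m : (0 < N)%N ->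
  \sum_(k < N) root_unity R N k ^+ m = if (N %| m)%N then N%:R else 0.
Proof.
move=> N0; have pr := prim_cis N0; set w := cis _ in pr.
have -> : \sum_(k < N) root_unity R N k ^+ m = \sum_(k < N) (w ^+ m) ^+ k.
  by apply: eq_bigr => k _; rewrite root_unityE -!exprM mulnC.
case: ifP => [|/negbT] hm; rewrite (prim_order_dvd pr) in hm.
  rewrite (eqP hm) (eq_bigr (fun=> 1)) ?sumr_const ?card_ord // => i _.
  by rewrite expr1n.
have := subrX1 (w ^+ m) N; rewrite exprAC (prim_expr_order pr) expr1n subrr.
by move=> /esym/eqP; rewrite mulf_eq0 subr_eq0 (negbTE hm) => /eqP.
Qed.

Lemma root_unityX N k : (0 < N)%N -> root_unity R N k ^+ N = 1.
Proof.
by move=> N0; rewrite root_unityE exprAC (prim_expr_order (prim_cis N0)) expr1n.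
Qed.

End RootsOfUnity.

(** * Iterates of [A] and the Riemann sums of the Riesz integral *)

Section Iterates.
Variables (R : realType) (V : normedModType R[i]) (A : {linear V -> V}).

Lemma iter_linear n a (x y : V) : iter n A (a *: x + y) = a *: iter n A x + iter n A y.
Proof. by elim: n => //= n ->; rewrite linearP. Qed.

Lemma iter_linear0 n : iter n A 0 = 0.
Proof. by elim: n => //= n ->; rewrite linear0. Qed.

Lemma iter_linearD n (x y : V) : iter n A (x + y) = iter n A x + iter n A y.
Proof. by rewrite -[x]scale1r iter_linear !scale1r. Qed.

Lemma iter_linearZ n a (x : V) : iter n A (a *: x) = a *: iter n A x.
Proof. by rewrite -[a *: x]addr0 iter_linear iter_linear0 !addr0. Qed.

Lemma iter_linearB n (x y : V) : iter n A (x - y) = iter n A x - iter n A y.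
Proof. by rewrite iter_linearD -scaleN1r iter_linearZ scaleN1r. Qed.

Lemma iter_linear_sum n (m : nat) (f : 'I_m -> V) :
  iter n A (\sum_(i < m) f i) = \sum_(i < m) iter n A (f i).
Proof.
elim: m f => [|m IH] f; first by rewrite !big_ord0 iter_linear0.
by rewrite !big_ord_recl iter_linearD IH.
Qed.

(** The factorization of [z^n - A^n] through [z - A], applied to a preimage [y] of [x] under
    [z - A]. *)
Lemma iter_eigen_defect n (z : R[i]) (x y : V) : z *: y - A y = x ->
  z ^+ n *: y - iter n A y = \sum_(j < n) z ^+ (n.-1 - j) *: iter j A x.
Proof.
move=> hy; have Ay : A y = z *: y - x by rewrite -hy subKr.
elim: n => [|n IH]; first by rewrite big_ord0 expr0 scale1r subrr.
rewrite iterSr Ay iter_linearB iter_linearZ opprB addrCA addrC exprS -scalerA -scalerBr IH.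
rewrite big_ord_recr /= subnn expr0 scale1r scaler_sumr; congr (_ + _).
apply: eq_bigr => j _; rewrite scalerA -exprS; congr (_ ^+ _ *: _).
by have := ltn_ord j; lia.
Qed.

(** As [z^(N+1) = 1], the operator [1 - A^(N+1)] maps each [z (z - A)^-1 x] to a polynomial in [A]
    applied to [x], with coefficients [z^(N+1-j)]; averaging over the roots of unity leaves only
    [x]. Thus the Riemann sum starts, exactly, an orbit that closes up after [N + 1] steps with
    defect [x]. *)
Lemma riesz_sum_inverse (x : V) N :
  (forall z : R[i], cabs z = 1 -> z *: resolvent A z x - A (resolvent A z x) = x) ->
  riesz_sum A x N - iter N.+1 A (riesz_sum A x N) = x.
Proof.
move=> hres; rewrite /riesz_sum iter_linearZ -scalerBr iter_linear_sum -sumrB.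
set z := fun k : 'I_N.+1 => root_unity R N.+1 k.
rewrite (eq_bigr (fun k => \sum_(j < N.+1) z k ^+ (N.+1 - j) *: iter j A x)); last first.
  move=> k _; rewrite iter_linearZ -scalerBr.
  have := iter_eigen_defect N.+1 (hres _ (cabs_root_unity R N.+1 k)).
  rewrite root_unityX // scale1r => ->; rewrite scaler_sumr; apply: eq_bigr => j _.
  rewrite scalerA -exprS; congr (_ ^+ _ *: _).
  by have := ltn_ord j; lia.
(* The exponents run from [1] to [N + 1], and only [j = 0] gives a multiple of [N + 1]. *)
have key (j : 'I_N.+1) : \sum_(k < N.+1) z k ^+ (N.+1 - j) *: iter j A x =
    if j == ord0 then N.+1%:R *: x else 0.
  rewrite -scaler_suml sum_root_unity //; case: eqP => [->|/eqP j0].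
    by rewrite subn0 dvdnn.
  have jN := ltn_ord j; have j1 : (0 < j)%N by rewrite lt0n.
  by rewrite gtnNdvd ?scale0r //; lia.
rewrite exchange_big (eq_bigr _ (fun j _ => key j)) -big_mkcond big_pred1_eq.
by rewrite scalerA mulVf ?scale1r // pnatr_eq0.
Qed.

End Iterates.

(** * Discrete Fourier transform and the cyclic estimate *)

Section Parseval.
Variables (R : realType) (V : normedModType R[i]) (ip : V -> V -> R[i]).
Hypothesis hip : inner_product_of_norm ip.

Lemma ip_suml n (f : 'I_n -> V) y : ip (\sum_(i < n) f i) y = \sum_(i < n) ip (f i) y.
Proof.
have [lin _ _] := hip.
have ip0 w : ip 0 w = 0.
  have := lin 1 0 0 w; rewrite scale1r addr0 mul1r => /eqP.
  by rewrite eq_sym -subr_eq0 addrK => /eqP.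
elim: n f => [|n IH] f; first by rewrite !big_ord0 ip0.
by rewrite !big_ord_recl -[f ord0]scale1r lin mul1r scale1r IH.
Qed.

Lemma ip_scalel a x y : ip (a *: x) y = a * ip x y.
Proof.
have [lin _ _] := hip.
have := lin a x 0 y; rewrite addr0 => ->.
by have := ip_suml (fun i : 'I_0 => x) y; rewrite !big_ord0 => ->; rewrite addr0.
Qed.

Lemma ip_sumr n (f : 'I_n -> V) x : ip x (\sum_(i < n) f i) = \sum_(i < n) ip x (f i).
Proof.
have [_ sym _] := hip; rewrite sym ip_suml rmorph_sum /=.
by apply: eq_bigr => i _; rewrite -sym.
Qed.

Lemma ip_scaler a x y : ip x (a *: y) = a^* * ip x y.
Proof. by have [_ sym _] := hip; rewrite sym ip_scalel rmorphM /= -sym. Qed.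

Definition dft N (u : nat -> V) k := \sum_(n < N) root_unity R N k ^+ n *: u n.

(** The conjugate of [z ^+ m] is written [z ^+ (N - m)] to keep exponents natural; after expansion
    of the inner products, orthogonality of the roots of unity leaves the diagonal [n = m]. *)
Lemma parseval N (u : nat -> V) : (0 < N)%N ->
  \sum_(k < N) nrm (dft N u k) ^+ 2 = N%:R * \sum_(n < N) nrm (u n) ^+ 2.
Proof.
move=> N0; apply: complexI; rewrite rmorphM !rmorph_sum /= rmorph_nat.
have [_ _ sq] := hip.
rewrite (eq_bigr (fun k : 'I_N => \sum_(n < N) \sum_(m < N)
    root_unity R N k ^+ (n + (N - m)) * ip (u n) (u m))); last first.
  move=> k _; rewrite rmorphXn /= nrm_complex -sq /dft ip_suml; apply: eq_bigr => n _.
  rewrite ip_sumr; apply: eq_bigr => m _; rewrite ip_scalel ip_scaler mulrA exprD.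
  congr (_ * _ * _); set z := root_unity R N k.
  have zN : z ^+ (N - m) * z ^+ m = 1.
    by rewrite -exprD subnK ?root_unityX // ltnW.
  have zz : z * z^* = 1.
    by rewrite -normCK -cabs_complex cabs_root_unity expr1n.
  by rewrite rmorphXn /= -[LHS]mul1r -zN -mulrA -exprMn zz expr1n mulr1.
rewrite exchange_big mulr_sumr; apply: eq_bigr => n _ /=.
rewrite exchange_big (bigD1 n) //= [X in _ + X]big1 => [|m mn]; last first.
  rewrite -mulr_suml sum_root_unity // ifF ?mul0r //; apply/negbTE.
  apply/negP => /dvdnP[q hq].
  have hn := ltn_ord n; have hm := ltn_ord m.
  have /eqP : (m : nat) <> n by move/val_inj/eqP; rewrite (negbTE mn).
  (* [0 < n + (N - m) < 2 N], so a multiple of [N] here is [N] itself. *)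
  have q1 : (q = 1)%N.
    case: q hq => [|[//|q]]; rewrite ?mulSn; lia.
  by move: hq; rewrite q1; lia.
rewrite -mulr_suml sum_root_unity // subnKC ?dvdnn 1?ltnW // addr0.
by rewrite rmorphXn /= nrm_complex sq.
Qed.

(** The transform turns the cyclic shift into multiplication by [z^-1], hence [u n.+1 - A (u n)]
    into [z^-1 - A] acting on the transform of [u]. The bound on the unit circle applies at each
    frequency, and Parseval sums up. *)
Lemma cyclic_bound (A : {linear V -> V}) (M : R) N (u : nat -> V) :
  (0 < N)%N -> 0 <= M ->
  (forall z : R[i], cabs z = 1 -> forall x, nrm x <= M * nrm (z *: x - A x)) ->
  u N = u 0%N ->
  \sum_(n < N) nrm (u n) ^+ 2 <= M ^+ 2 * \sum_(n < N) nrm (u n.+1 - A (u n)) ^+ 2.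
Proof.
move=> N0 M0 hM hper; have NR : 0 < N%:R :> R by rewrite ltr0n.
rewrite -(ler_pM2l NR) mulrCA -(parseval u N0) -(parseval (fun n => u n.+1 - A (u n)) N0) mulr_sumr.
apply: ler_sum => k _; rewrite -exprMn ler_pXn2r ?nnegrE ?mulr_ge0 ?nrm_ge0 //.
set z := root_unity R N k.
have z0 : z != 0.
  apply/eqP => z0; have := cabs_root_unity R N k; rewrite -/z z0 /cabs normr0 => /eqP.
  by rewrite eq_sym oner_eq0.
have -> : dft N (fun n => u n.+1 - A (u n)) k = z^-1 *: dft N u k - A (dft N u k).
  rewrite /dft -/z [X in _ - X]linear_sum.
  rewrite (eq_bigr (fun n : 'I_N => z ^+ n *: u n.+1 - A (z ^+ n *: u n))); last first.
    by move=> n _; rewrite scalerBr [A (_ *: _)]linearZ.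
  rewrite sumrB; congr (_ - _).
  (* Reindexing of the cyclic sum: the terms [n = 0] and [n = N] agree by periodicity. *)
  have -> : \sum_(n < N) z ^+ n *: u n = \sum_(n < N) z ^+ n.+1 *: u n.+1.
    apply: (@addIr _ (u N)).
    have e1 : z ^+ N *: u N = u N by rewrite root_unityX // scale1r.
    transitivity (\sum_(n < N.+1) z ^+ n *: u n).
      by rewrite big_ord_recr /= e1.
    by rewrite big_ord_recl /= expr0 scale1r addrC hper.
  by rewrite scaler_sumr; apply: eq_bigr => n _; rewrite scalerA exprS mulKf.
by apply: hM; rewrite cabsV cabs_root_unity invr1.
Qed.

End Parseval.

(** * The a priori bound *)

Section ShiftMinusA.
Variables (R : realType) (V : completeNormedModType R[i]) (ip : V -> V -> R[i]).
Hypothesis hip : inner_product_of_norm ip.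
Variables (A : {linear V -> V}) (C : R).
Hypotheses (C_ge0 : 0 <= C) (A_le : forall x, nrm (A x) <= C * nrm x).

Definition tauA (u : int -> V) : int -> V := fun k => u (k + 1) - A (u k).

(** The resolvent bound [|(z - A)^-1| <= M] on the circle, phrased without an inverse. *)
Definition lower_bound (gamma M : R) :=
  forall z : R[i], cabs z = gamma -> forall x : V, nrm x <= M * nrm (z *: x - A x).

Lemma tauAD u v k : tauA (fun k => u k + v k) k = tauA u k + tauA v k.
Proof. by rewrite /tauA linearD opprD addrACA. Qed.

Lemma tauAB u v k : tauA (fun k => u k - v k) k = tauA u k - tauA v k.
Proof. by rewrite /tauA linearB !opprB addrACA [RHS]addrACA [- A _ - _]addrC. Qed.

Lemma tauA_lim (u_ : nat -> int -> V) u k :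
  (forall j, vconv (fun n => u_ n j) (u j)) -> vconv (fun n => tauA (u_ n) k) (tauA u k).
Proof. by move=> h; apply: vconvB => //; apply: vconv_bounded_linear A_le _. Qed.

Section Weight.
Variables (gamma M : R).
Hypotheses (gamma_gt0 : 0 < gamma) (M_ge0 : 0 <= M).

Lemma l2bd_tauA v e : 0 <= e -> l2bd gamma v e -> l2bd gamma (tauA v) ((gamma + C) * e).
Proof.
move=> e0 hv; rewrite mulrDl; apply: l2bdB => //; rewrite ?mulr_ge0 ?(ltW gamma_gt0) //.
  by have := l2bd_shift gamma_gt0 1 hv; rewrite expr1z.
exact: (l2bd_dom gamma_gt0 C_ge0 (fun k => A_le (v k)) hv).
Qed.

Hypothesis A_lb : lower_bound gamma M.

(* A finitely supported sequence is periodic on any window enlarging its support, so the cyclic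
   Parseval bound applies to the rescaled sequence [gamma ^ - k v_k] and the operator [A / gamma] *)
Lemma apriori_cc v c : in_cc v -> l2bd gamma (tauA v) c -> l2bd gamma v (M * c).
Proof.
move=> [N hN] hg; apply: l2bd_sym => // K; set K' := (K + N).+1; exists K'; first by rewrite /K'; lia.
set a := - K'%:Z; set n := (K' + K')%N.
have g0 : gamma != 0 by rewrite gt_eqF.
pose w k := gamma ^ (- k); have w0 k : 0 < w k by rewrite exprz_gt0.
have wS k : w (k + 1) = w k * gamma^-1 by rewrite /w opprD expfzDr.
have wt f k : wterm gamma f k = nrm ((w k)%:C%C *: f k) ^+ 2.
  by rewrite nrmZr ?ltW // exprMn /w exprz_sqr mulrN mulrC.
pose u (i : nat) := (w (a + i%:Z))%:C%C *: v (a + i%:Z).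
have hu0 : u n = u 0%N.
  by rewrite /u !hN ?scaler0 // /a /n /K'; lia.
pose B : {linear V -> V} := (gamma^-1)%:C%C \*: A.
have hB z : cabs z = 1 -> forall x, nrm x <= (M * gamma) * nrm (z *: x - B x).
  move=> z1 x; have := A_lb (z := gamma%:C%C * z).
  rewrite cabsM z1 mulr1 cabs_pos ?(ltW gamma_gt0) // => /(_ erefl x) /le_trans; apply.
  rewrite -mulrA ler_wpM2l // -nrmZr ?(ltW gamma_gt0) // scalerBr scalerA.
  by rewrite /= scalerA -rmorphM divff // scale1r.
have M'0 : 0 <= M * gamma by rewrite mulr_ge0 // ltW.
have := cyclic_bound hip (N := n) _ M'0 hB hu0.
have -> : \sum_(i < n) nrm (u i) ^+ 2 = en gamma v a n.
  by apply: eq_bigr => i _; rewrite wt.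
have -> : \sum_(i < n) nrm (u i.+1 - B (u i)) ^+ 2 = gamma^-1 ^+ 2 * en gamma (tauA v) a n.
  rewrite /en mulr_sumr; apply: eq_bigr => i _; rewrite wt -exprMn -nrmZr ?invr_ge0 ?(ltW gamma_gt0) //.
  congr (nrm _ ^+ 2); rewrite /u /= /tauA.
  have -> : a + i.+1%:Z = a + i%:Z + 1 by lia.
  by rewrite wS [A (_ *: _)]linearZ /= !scalerA scalerBr rmorphM /= [_ * (gamma^-1)%:C%C]mulrC.
move=> h; apply: le_trans (h _) _ => //.
rewrite mulrA -exprMn mulfK // exprMn ler_wpM2l ?sqr_ge0 //.
Qed.

Lemma apriori u c : in_l2w gamma u -> 0 <= c -> l2bd gamma (tauA u) c -> l2bd gamma u (M * c).
Proof.
move=> hu c0 hg; apply: l2bd_closed => [||e e0] //; first exact: mulr_ge0.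
(* Truncating within [d] changes the sequence by [d] and its image under [tau - A] by
   [(gamma + C) d]; [D] makes the total error [M (gamma + C) d + d] equal to [D d = e]. *)
set D := M * (gamma + C) + 1.
have D0 : 0 < D by rewrite ltr_wpDl // mulr_ge0 // addr_ge0 // ltW.
have [N hN] := l2bd_trunc gamma_gt0 hu (divr_gt0 e0 D0).
have {hN} hN := hN N (leqnn N); set d := e / D in hN.
have d0 : 0 < d by rewrite divr_gt0.
have h1 : l2bd gamma (tauA (trunc N u)) (c + (gamma + C) * d).
  apply: (@l2bd_ext _ _ _ _ (fun k => tauA u k - tauA (fun k => u k - trunc N u k) k)).
    by move=> k; rewrite tauAB subKr.
  apply: l2bdB => //; first by rewrite mulr_ge0 ?addr_ge0 ?(ltW d0) // ltW.
  exact: l2bd_tauA (ltW d0) hN.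
have h2 := apriori_cc (in_cc_trunc N u) h1.
have -> : M * c + e = M * (c + (gamma + C) * d) + d.
  have <- : D * d = e by rewrite mulrC divfK ?gt_eqF.
  by rewrite /D; ring.
apply: (@l2bd_ext _ _ _ _ (fun k => trunc N u k + (u k - trunc N u k))).
  by move=> k; rewrite addrC subrK.
have e1 : 0 <= c + (gamma + C) * d by rewrite addr_ge0 // mulr_ge0 ?addr_ge0 // ltW.
by apply: l2bdD => //; [exact: mulr_ge0|exact: ltW].
Qed.

Lemma tauA_inj u v : in_l2w gamma u -> in_l2w gamma v ->
  (forall k, tauA u k = tauA v k) -> u = v.
Proof.
move=> hu hv h; apply/funext => k; apply/eqP; rewrite -subr_eq0; apply/eqP.
have : l2bd gamma (fun k => u k - v k) (M * 0).
  apply: apriori => //; first exact: in_l2wB.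
  apply: (l2bd_ext (v := fun=> 0)) => [{}k|]; first by rewrite tauAB h subrr.
  exact: l2bd0.
by rewrite mulr0 => /(l2bd_le0 gamma_gt0); apply.
Qed.

(** Shifted Green functions and finite sums solve the equation for every truncation of [g]; the a
    priori bound makes these solutions Cauchy, and the limit solves it for [g]. *)
Lemma tauA_surj :
  (forall x, exists2 h, in_l2w gamma h & forall k, tauA h k = delta (-1) x k) ->
  forall g, in_l2w gamma g -> exists2 u, in_l2w gamma u & forall k, tauA u k = g k.
Proof.
move=> green.
have green' m x : exists2 h, in_l2w gamma h & forall k, tauA h k = delta m x k.
  have [h hin he] := green x; exists (fun k => h (k + (- 1 - m))); first exact: in_l2w_shift.
  move=> k; have := he (k + (- 1 - m)); rewrite /tauA addrAC => ->; rewrite /delta.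
  by congr (if _ then _ else _); lia.
have win n : forall a (g : int -> V), exists2 u, in_l2w gamma u &
    forall k, tauA u k = if a <= k < a + n%:Z then g k else 0.
  elim: n => [|n IH] a g.
    exists (fun=> 0); first exact: (l2bd_in gamma_gt0 (l2bd0 V gamma_gt0)).
    by move=> k; case: ifP => [|_]; [lia|rewrite /tauA linear0 subrr].
  have [u hu ue] := IH a g; have [h hh he] := green' (a + n%:Z) (g (a + n%:Z)).
  exists (fun k => u k + h k); first exact: in_l2wD.
  move=> k; rewrite tauAD ue he /delta; case: (k =P a + n%:Z) => [->|kn].
    by rewrite ifF ?ifT ?add0r //; [lia | apply/negbTE; lia].
  by rewrite addr0; congr (if _ then _ else _); lia.
move=> g hg.
have /choice[u hu] : forall n, exists u, in_l2w gamma u /\ forall k, tauA u k = trunc n g k.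
  move=> n; have [u hu ue] := win (n + n)%N (- n%:Z) g; exists u; split=> // k.
  by rewrite ue /trunc; congr (if _ then _ else _); lia.
have [|e e0|v hv uv] := @l2_complete _ V gamma gamma_gt0 u.
- by move=> n; have [] := hu n.
- have D0 : 0 < M + 1 by rewrite ltr_wpDl.
  have e2 : 0 < e / (M + 1) / 2 by rewrite !divr_gt0.
  have [N hN] := l2bd_trunc gamma_gt0 hg e2; exists N => m n Nm Nn.
  set d := e / (M + 1).
  have hd : l2bd gamma (fun k => u m k - u n k) (M * d).
    apply: apriori.
    - by apply: in_l2wB => //; [have [] := hu m|have [] := hu n].
    - by rewrite divr_ge0 ?ltW.
    apply: (@l2bd_ext _ _ _ _ (fun k => (g k - trunc n g k) - (g k - trunc m g k))).
      by move=> k; rewrite tauAB (hu m).2 (hu n).2 opprB [RHS]addrC addrA subrK.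
    have -> : d = d / 2 + d / 2 by field.
    by apply: l2bdB; rewrite ?(ltW e2) //; apply: hN.
  have d0 : 0 < d by apply: divr_gt0.
  apply: (l2bd_le _ _ hd); first by apply: mulr_ge0 => //; exact: ltW.
  by rewrite /d mulrA ler_pdivrMr // mulrC ler_pM2l // lerDl.
exists v => // k; apply: (@vconv_unique _ _ (fun n => trunc n g k)).
  have -> : (fun n => trunc n g k) = (fun n => tauA (u n) k).
    by apply/funext => n; rewrite -(hu n).2.
  by apply: tauA_lim => j; apply: (l2conv_point gamma_gt0).
move=> e e0; exists `|k|.+1 => n kn; rewrite /trunc ifT ?subrr ?nrm0 ?(ltW e0) //.
by lia.
Qed.

End Weight.
End ShiftMinusA.

Lemma geo_small (R : realType) (a q e : R) : 0 <= a -> 0 <= q -> q < 1 -> 0 < e ->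
  exists N, forall n, (N <= n)%N -> a * q ^+ n <= e.
Proof.
move=> a0 q0 q1 e0; have a1 : 0 < a + 1 by rewrite ltr_wpDl.
have : (GRing.exp q : nat -> R) @ \oo --> (0 : R) by apply: cvg_expr; rewrite ger0_norm.
move/cvgrPdist_le => /(_ _ (divr_gt0 e0 a1))[N _ hN]; exists N => n /hN /=.
rewrite sub0r normrN ger0_norm ?exprn_ge0 // ler_pdivlMr // mulrC; apply: le_trans.
by rewrite ler_wpM2r ?exprn_ge0 // lerDl.
Qed.

(** * Spectrum and resolvent bounds *)

Section BoundedInverse.
Variables (R : realType) (V : completeNormedModType R[i]).

Lemma vconv_dist (u : nat -> V) l y c :
  vconv u l -> (forall n, nrm (u n - y) <= c) -> nrm (l - y) <= c.
Proof.
move=> h hc; apply/ler_addgt0Pr => e e0; have [N hN] := h e e0.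
apply: le_trans (nrm_triangle _ (u N) _) _; rewrite addrC lerD // nrm_distC; exact: hN.
Qed.

(** Shared by the nested balls of [level_set_dense], the series in [bounded_below] and the iteration
    in [in_spectrum_bounded]. *)
Lemma geometric_limit (u : nat -> V) (a : R) : 0 <= a ->
  (forall n, nrm (u n.+1 - u n) <= a * (1 / 2) ^+ n) ->
  exists2 l, vconv u l & nrm (l - u 0%N) <= 2 * a.
Proof.
move=> a0 h; have half : 0 <= 1 / 2 :> R by lra.
(* The factor [1 - (1/2)^k] is the exact partial geometric sum, which lets the induction close. *)
have hk n k : nrm (u (n + k)%N - u n) <= 2 * a * (1 / 2) ^+ n * (1 - (1 / 2) ^+ k).
  elim: k => [|k IH]; first by rewrite addn0 subrr nrm0 expr0 subrr mulr0.
  apply: le_trans (nrm_triangle _ (u (n + k)%N) _) _.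
  rewrite addnS; have := h (n + k)%N; rewrite exprD exprS.
  set p := _ ^+ n in IH *; set q := _ ^+ k in IH *.
  move: IH; lra.
have h2 n k : nrm (u (n + k)%N - u n) <= 2 * a * (1 / 2) ^+ n.
  apply: le_trans (hk n k) _; apply: ler_piMr; last by rewrite gerBl exprn_ge0.
  by rewrite !mulr_ge0 ?exprn_ge0.
have [|l hl] := @vconv_cauchy _ _ u.
  move=> e e0; have [||||N hN] := @geo_small _ (2 * a) (1 / 2) (e / 2); rewrite ?mulr_ge0 //; try lra.
  exists N => m n Nm Nn.
  apply: le_trans (nrm_triangle _ (u N) _) _; rewrite [nrm (u N - _)]nrm_distC.
  have [h3 h4] := (h2 N (m - N)%N, h2 N (n - N)%N).
  rewrite !subnKC // in h3 h4; have := hN N (leqnn N); lra.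
exists l => //; apply: vconv_dist hl _ => n.
by have := h2 0%N n; rewrite expr0 mulr1 add0n.
Qed.

Variables (B : {linear V -> V}) (C : R).
Hypothesis B_le : forall x, nrm (B x) <= C * nrm x.

(* The Baire step: if every level set [{w | nrm (Bi w) <= n}] were nowhere dense, nested balls
   would produce a point outside all of them. *)
Lemma level_set_dense (Bi : V -> V) :
  exists n y0 r, 0 < r /\ forall y, nrm (y - y0) <= r -> forall e, 0 < e ->
    exists w, nrm (w - y) <= e /\ nrm (Bi w) <= n%:R.
Proof.
apply: contrapT => hno.
have step : forall t : nat * (V * R), exists s : V * R, 0 < t.2.2 ->
    [/\ 0 < s.2, s.2 <= t.2.2 / 2, nrm (s.1 - t.2.1) <= t.2.2 / 2 &
      forall w, nrm (w - s.1) <= s.2 -> t.1%:R < nrm (Bi w)].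
  (* The pair [(0, 0)] is a placeholder where [r <= 0] and the implication is void. *)
  move=> [n [y r]] /=; case: (ltP 0 r) => [r0|]; last by exists (0, 0).
  have r2 : 0 < r / 2 by rewrite divr_gt0.
  apply: contrapT => hn; apply: hno; exists n, y, (r / 2); split=> // y1 hy1 e e0.
  (* The [e]-ball around [y1] misses the level set; capping its radius by [r / 2] makes the radii
     halve. *)
  apply: contrapT => hw; apply: hn; exists (y1, Num.min e (r / 2)) => _; split=> //=.
  - by rewrite lt_min e0.
  - by rewrite ge_min lexx orbT.
  - move=> w; rewrite le_min => /andP[we _]; rewrite ltNge; apply/negP => wn.
    by apply: hw; exists w.
have [f hf] := choice step.
pose s := fix s n : V * R := if n is m.+1 then f (m, s m) else (0, 1).
have s0 n : 0 < (s n).2.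
  by elim: n => [|n IH] /=; [exact: ltr01|have [] := hf (n, s n) IH].
have hs n := hf (n, s n) (s0 n).
have sk n k : (s (n + k)%N).2 <= (s n).2 * (1 / 2) ^+ k.
  elim: k => [|k IH]; first by rewrite addn0 mulr1.
  rewrite addnS exprS; have [_ + _ _] := hs (n + k)%N; rewrite /= in IH *; lra.
have lim n : exists2 l, vconv (fun k => (s (n + k)%N).1) l & nrm (l - (s n).1) <= (s n).2.
  have [||l hl hd] := @geometric_limit (fun k => (s (n + k)%N).1) ((s n).2 / 2).
  - by rewrite divr_ge0 // ltW.
  - move=> k; rewrite addnS; have [_ _ + _] := hs (n + k)%N; have := sk n k.
    by rewrite /=; lra.
  by exists l => //; rewrite addn0 in hd; apply: le_trans hd _; lra.
have [l hl _] := lim 0%N.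
(* The common limit of the centres lies in ball number [n + 1], where [nrm (Bi w)] exceeds [n]. *)
have hln n : n%:R < nrm (Bi l).
  have [l' hl' hd] := lim n.+1; have [_ _ _] := hs n; apply => /=.
  suff -> : l = l' by [].
  apply: vconv_unique hl' => e e0; have [N hN] := hl e e0; exists N => k Nk.
  by have := hN (n.+1 + k)%N; rewrite add0n; apply; lia.
have := hln (Num.truncn (nrm (Bi l))).+1.
by rewrite ltNge => /negP; apply; apply/ltW/truncnS_gt.
Qed.

(** The bounded inverse theorem. Every [y] is approximated by some [w] whose preimage is at most
    [K nrm y]; correcting the remainder repeatedly, with errors halving, writes [B x] as a series
    whose preimages sum to [x] by continuity of [B]. *)
Lemma bounded_below : bijective B ->
  exists2 M : R, 0 < M & forall x, nrm x <= M * nrm (B x).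
Proof.
move=> [Bi BK BiK].
have BiB x y : Bi (x - y) = Bi x - Bi y by rewrite -{1}[x]BiK -{1}[y]BiK -linearB BK.
have BiZ a x : Bi (a *: x) = a *: Bi x by rewrite -{1}[x]BiK -linearZ BK.
have Bi0 : Bi 0 = 0 by rewrite -{1}[0](linear0 B) BK.
have [n [y0 [r [r0 hd]]]] := level_set_dense Bi.
(* Half the difference of approximants of [y0 + y] and [y0 - y] moves the ball from [y0] to the
   origin. *)
have small y e : nrm y <= r -> 0 < e -> exists w, nrm (w - y) <= e /\ nrm (Bi w) <= n%:R.
  move=> hy e0.
  have [|w1 [d1 p1]] := hd (y0 + y) _ e e0; first by rewrite addrC addKr.
  have [|w2 [d2 p2]] := hd (y0 - y) _ e e0; first by rewrite addrC addKr nrmN.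
  have half : 0 <= 1 / 2 :> R by lra.
  exists ((1 / 2 : R)%:C%C *: (w1 - w2)); split.
    have -> : (1 / 2 : R)%:C%C *: (w1 - w2) - y =
        (1 / 2 : R)%:C%C *: ((w1 - (y0 + y)) - (w2 - (y0 - y))).
      have -> : w1 - (y0 + y) - (w2 - (y0 - y)) = w1 - w2 - (y + y).
        by rewrite !opprD !opprK addrACA [X in _ + X = _]addrACA addNr add0r.
      rewrite [RHS]scalerBr [X in _ = _ - X]scalerDr -scalerDl -rmorphD /=.
      have -> : 1 / 2 + 1 / 2 = 1 :> R by field.
      by rewrite scale1r.
    by rewrite nrmZr //; have := nrmB (w1 - (y0 + y)) (w2 - (y0 - y)); lra.
  by rewrite BiZ BiB nrmZr //; have := nrmB (Bi w1) (Bi w2); lra.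
set K := n%:R / r; have K0 : 0 <= K by rewrite divr_ge0 ?ler0n // ltW.
have approx (t : V * R) : exists w, 0 < t.2 -> nrm (w - t.1) <= t.2 /\ nrm (Bi w) <= K * nrm t.1.
  move: t => [y e] /=; case: (ltP 0 e) => [e0|]; last by exists 0.
  have [->|yn0] := eqVneq y 0.
    by exists 0; rewrite subrr Bi0 nrm0 mulr0 ltW.
  have y1 := nrm_gt0 yn0; set c := nrm y / r; have c0 : 0 < c by rewrite divr_gt0.
  have cc : c%:C%C * (c^-1)%:C%C = 1 :> R[i] by rewrite -rmorphM divff ?gt_eqF.
  have [||w [d p]] := small ((c^-1)%:C%C *: y) (c^-1 * e).
  - by rewrite nrmZr ?invr_ge0 ?(ltW c0) // /c invf_div divfK ?gt_eqF.
  - by rewrite mulr_gt0 ?invr_gt0.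
  exists (c%:C%C *: w) => _; split.
    have -> : c%:C%C *: w - y = c%:C%C *: (w - (c^-1)%:C%C *: y).
      by rewrite scalerBr scalerA cc scale1r.
    by rewrite nrmZr ?(ltW c0) // -ler_pdivlMl.
  rewrite BiZ nrmZr ?(ltW c0) //.
  have -> : K * nrm y = c * n%:R by rewrite /K /c; ring.
  by rewrite ler_wpM2l // ltW.
have [f hf] := choice approx.
exists (2 * K + 1) => [|x]; first by lra.
set y := B x; have y0' := nrm_ge0 y.
have [y00|yn0] := eqVneq y 0.
  by rewrite y00 nrm0 mulr0 -[x]BK -/y y00 Bi0 nrm0.
have yp := nrm_gt0 yn0.
(* [rest k] is what remains of [y] after [k] corrections, at most [nrm y (1/2)^k]; [w k] is the next
   correction. *)
pose rest := fix rest k : V := if k is m.+1 then rest m - f (rest m, nrm y * (1 / 2) ^+ m.+1) else y.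
pose w k := f (rest k, nrm y * (1 / 2) ^+ k.+1).
have ep k : 0 < nrm y * (1 / 2) ^+ k by rewrite mulr_gt0 // exprn_gt0 //; lra.
have hw k : nrm (w k - rest k) <= nrm y * (1 / 2) ^+ k.+1 /\ nrm (Bi (w k)) <= K * nrm (rest k).
  exact: hf (rest k, _) (ep k.+1).
have hrest k : nrm (rest k) <= nrm y * (1 / 2) ^+ k.
  case: k => [|k]; first by rewrite expr0 mulr1.
  by rewrite /= nrm_distC; have [] := hw k.
pose X k := Bi (y - rest k).
have X0 : X 0%N = 0 by rewrite /X subrr Bi0.
have [||l hl] := @geometric_limit X (K * nrm y).
- by rewrite mulr_ge0.
- move=> k; have -> : X k.+1 - X k = Bi (w k).
    by rewrite /X -BiB /= -/(w k) !opprB !addrA subrK [y + _]addrC addrK.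
  have [_ h] := hw k; apply: le_trans h _; rewrite -[X in _ <= X]mulrA; apply: ler_wpM2l => //; exact: hrest.
rewrite X0 subr0 => hb; suff <- : l = x by lra.
apply: (can_inj BK); apply: (@vconv_unique _ _ (fun k => B (X k))).
  exact: vconv_bounded_linear B_le hl.
have half1 : 1 / 2 < 1 :> R by lra.
have half0 : 0 <= 1 / 2 :> R by lra.
move=> e e0; have [//|//|//|//|N hN] := @geo_small _ (nrm y) (1 / 2) e.
exists N => k /hN; apply: le_trans; rewrite /X BiK -/y addrAC subrr sub0r nrmN.
exact: hrest.
Qed.

End BoundedInverse.

Lemma cabs_le_ReIm (R : realType) (z : R[i]) : cabs z <= `|complex.Re z| + `|complex.Im z|.
Proof.
rewrite cabsE -[X in _ <= X]ger0_norm ?addr_ge0 // -sqrtr_sqr ler_wsqrtr //.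
rewrite -(real_normK (num_real (complex.Re z))) -(real_normK (num_real (complex.Im z))).
by have := mulr_ge0 (normr_ge0 (complex.Re z)) (normr_ge0 (complex.Im z)); nra.
Qed.

Lemma Re_le_cabs (R : realType) (z : R[i]) : `|complex.Re z| <= cabs z.
Proof. by rewrite cabsE -sqrtr_sqr ler_wsqrtr // lerDl sqr_ge0. Qed.

Lemma Im_le_cabs (R : realType) (z : R[i]) : `|complex.Im z| <= cabs z.
Proof. by rewrite cabsE -sqrtr_sqr ler_wsqrtr // lerDr sqr_ge0. Qed.

(** * Uniform resolvent bounds by compactness, and boundedness of the spectrum *)

Section Spectrum.
Variables (R : realType) (V : completeNormedModType R[i]).
Variables (A : {linear V -> V}) (C : R).
Hypotheses (C_ge0 : 0 <= C) (A_le : forall x, nrm (A x) <= C * nrm x).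

Lemma resolvent_set_lb z : ~ in_spectrum A z ->
  exists2 M : R, 0 < M & forall x, nrm x <= M * nrm (z *: x - A x).
Proof.
move=> /contrapT hz.
have linB : linear (fun x : V => z *: x - A x).
  by move=> a x y; rewrite linearP scalerDr opprD addrACA scalerBr !scalerA mulrC.
pose B : {linear V -> V} := HB.pack (fun x : V => z *: x - A x)
  (GRing.isLinear.Build R[i] V V *:%R _ linB).
apply: (@bounded_below _ _ B (cabs z + C)) => // x.
by rewrite mulrDl -nrmZ (le_trans (nrmB _ _)) // lerD2l.
Qed.

(** Compactness of a square containing the annulus. Near a point of the annulus the constant at most
    doubles; near any other point the claim is void on a small ball, the annulus being closed. *)
Lemma annulus_lb r1 r2 :
  (forall z, r1 <= cabs z <= r2 -> ~ in_spectrum A z) ->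
  exists2 M : R, 0 < M &
    forall z, r1 <= cabs z <= r2 -> forall x, nrm x <= M * nrm (z *: x - A x).
Proof.
move=> hz; pose box := `[- r2, r2]%classic `*` `[- r2, r2]%classic : set (R * R).
have cbox : compact box by apply: compact_setX; apply: segment_compact.
pose Z (p : R * R) : R[i] := (p.1 +i* p.2)%C.
pose P (n : nat) p := r1 <= cabs (Z p) <= r2 ->
  forall x, nrm x <= n%:R * nrm (Z p *: x - A x).
have ZB (p q : R * R) d : ball p d q -> cabs (Z p - Z q) < 2 * d.
  move=> [/= h1 h2]; apply: le_lt_trans (cabs_le_ReIm _) _ => /=.
  by rewrite mulr_natl mulr2n; apply: ltrD.
have near_P p : box p -> \forall q \near p & n \near \oo, P n q.
  move=> _; case: (boolP (r1 <= cabs (Z p) <= r2)) => hp.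
    have [M M0 hM] := resolvent_set_lb (hz _ hp).
    (* Within this radius [z] moves by less than [1 / (2 M)], which costs at most half of [nrm x]
       and so doubles the constant. *)
    have d0 : 0 < (4 * M)^-1 by rewrite invr_gt0 mulr_gt0.
    exists (ball p (4 * M)^-1, [set n | (Num.truncn (2 * M) < n)%N]) => /=.
      by split; [exact: nbhsx_ballx|exists (Num.truncn (2 * M)).+1].
    move=> [q n] /= [hq hn] _ x.
    have n2 : 2 * M <= n%:R.
      by apply: ltW; apply: lt_le_trans (truncnS_gt _) _; rewrite ler_nat.
    have h := hM x; have zb := ZB _ _ _ hq; have x0 := nrm_ge0 x.
    have e : Z p *: x - A x = (Z q *: x - A x) + (Z p - Z q) *: x.
      by rewrite scalerBl [RHS]addrC addrA subrK.
    have h2 := nrmD (Z q *: x - A x) ((Z p - Z q) *: x); rewrite -e nrmZ in h2.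
    have w0 := nrm_ge0 (Z q *: x - A x).
    apply: (@le_trans _ _ (2 * M * nrm (Z q *: x - A x))); last by rewrite ler_wpM2r.
    have h3 : cabs (Z p - Z q) * nrm x <= (2 * M)^-1 * nrm x.
      rewrite ler_wpM2r // (le_trans (ltW zb)) // le_eqVlt; apply/orP; left.
      by apply/eqP; field; rewrite gt_eqF.
    have h4 : M * nrm (Z p *: x - A x) <= M * nrm (Z q *: x - A x) + nrm x / 2.
      have -> : nrm x / 2 = M * ((2 * M)^-1 * nrm x) by field; rewrite gt_eqF.
      rewrite -mulrDr; apply: ler_wpM2l; first exact: ltW.
      by apply: le_trans h2 _; rewrite lerD2l.
    lra.
  (* Half the gap to the annulus, since [Z] moves by less than [2 d]. *)
  pose d := if cabs (Z p) < r1 then (r1 - cabs (Z p)) / 2 else (cabs (Z p) - r2) / 2.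
  have d0 : 0 < d.
    rewrite /d; case: (ltP (cabs (Z p)) r1) => h; first by lra.
    by move: hp; rewrite h /= -ltNge; lra.
  exists (ball p d, setT) => /=; first by split; [exact: nbhsx_ballx|exact: filterT].
  move=> [q n] /= [hq _] hq2; exfalso; have zb := ZB _ _ _ hq.
  have h1 := cabsD (Z p - Z q) (Z q); rewrite subrK in h1.
  have h2 := cabsD (Z q - Z p) (Z p); rewrite subrK in h2.
  have e : cabs (Z q - Z p) = cabs (Z p - Z q) by rewrite -opprB /cabs normrN.
  rewrite e in h2; move: hp hq2 zb; rewrite /d; case: (ltP (cabs (Z p)) r1) => h; first by lra.
  by rewrite /= -ltNge => ? /andP[? ?] ?; lra.
have /compact_near_coveringP/(_ nat \oo P _ near_P)[N _ hN] := cbox.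
exists N.+1%:R => // z hz1 x.
have hz2 := andP hz1.
have h := hN N.+1 (leqnSn N) (complex.Re z, complex.Im z).
have zE : Z (complex.Re z, complex.Im z) = z by case: (z).
rewrite /P zE in h; apply: h => //; split => /=; rewrite in_itv /= -ler_norml.
  by apply: le_trans (Re_le_cabs z) _; case: hz2.
by apply: le_trans (Im_le_cabs z) _; case: hz2.
Qed.

Section Circle.
Variable gamma : R.
Hypothesis gamma_ge0 : 0 <= gamma.
Hypothesis circle : forall z, cabs z = gamma -> ~ in_spectrum A z.

Lemma resolventK z x : cabs z = gamma -> resolvent A z (z *: x - A x) = x.
Proof.
move=> /circle/contrapT bij; apply: (bij_inj bij).
exact: (@xgetPex _ 0 [set y | z *: y - A y = z *: x - A x] (ex_intro _ x erefl)).
Qed.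

Lemma resolvent_eq z x : cabs z = gamma -> z *: resolvent A z x - A (resolvent A z x) = x.
Proof.
move=> hz; have /contrapT[g gK Kg] := circle hz.
by rewrite -{1 2}[x]Kg !resolventK.
Qed.

(** [annulus_lb] with both radii equal to [gamma] bounds the set from above, so that [sup] is a
    genuine supremum; scaling [z *: x - A x] to norm one does the rest. *)
Lemma resolvent_sup_lb :
  0 <= resolvent_sup A gamma /\ lower_bound A gamma (resolvent_sup A gamma).
Proof.
have [|M M0 hM] := @annulus_lb gamma gamma.
  by move=> z hz; apply: circle; apply/eqP; rewrite eq_le andbC.
rewrite /resolvent_sup; set S := [set r : R | _].
have ubS : has_ubound S.
  exists M => r [z [x [hz hx ->]]].
  have := hM z _ (resolvent A z x); rewrite resolvent_eq // hz lexx => /(_ isT) /le_trans; apply.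
  by rewrite -[X in _ <= X]mulr1 ler_wpM2l // ltW.
have supS r : S r -> r <= sup S by apply: ub_le_sup.
have g1 : cabs (gamma%:C%C) = gamma by rewrite cabs_pos.
have r0 x : cabs x = gamma -> resolvent A x 0 = 0.
  by move=> hx; have := resolventK 0 hx; rewrite scaler0 linear0 subrr.
split.
  by apply: supS; exists gamma%:C%C, 0; split; rewrite ?nrm0 ?r0 ?nrm0 ?ler01.
move=> z hz x; set y := z *: x - A x.
have [y0|y0] := eqVneq y 0.
  by have := resolventK x hz; rewrite -/y y0 r0 // => <-; rewrite nrm0 mulr0.
have yp := nrm_gt0 y0.
have yi0 : 0 <= (nrm y)^-1 by rewrite invr_ge0 ltW.
rewrite -ler_pdivrMr //; apply: supS; exists z, (((nrm y)^-1)%:C%C *: y); split=> //.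
  by rewrite nrmZr // mulVf ?gt_eqF.
have -> : ((nrm y)^-1)%:C%C *: y = z *: (((nrm y)^-1)%:C%C *: x) - A (((nrm y)^-1)%:C%C *: x).
  by rewrite [A _]linearZ /= /y scalerBr !scalerA mulrC.
by rewrite resolventK // nrmZr // mulrC.
Qed.

End Circle.

(** Beyond this radius [x |-> z^-1 (y + A x)] contracts by [1/2], so [z - A] is bijective. The crude
    bound makes [spectral_radius] a genuine supremum. *)
Lemma in_spectrum_bounded z : in_spectrum A z -> cabs z <= 2 * C + 1.
Proof.
move=> hz; rewrite leNgt; apply/negP => hC; apply: hz.
have zp : 0 < cabs z by apply: le_lt_trans hC; rewrite addr_ge0 ?mulr_ge0.
have z0 : z != 0 by apply/eqP => z0; move: zp; rewrite z0 /cabs normr0 ltxx.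
have surj y : exists x, z *: x - A x = y.
  pose f x := z^-1 *: (y + A x).
  pose u := fix u n : V := if n is m.+1 then f (u m) else 0.
  have fB a b : nrm (f a - f b) <= nrm (a - b) * (1 / 2).
    rewrite /f -scalerBr opprD addrACA subrr add0r -linearB nrmZ cabsV.
    rewrite mulrC ler_pdivrMr //; apply: le_trans (A_le _) _.
    by have := nrm_ge0 (a - b); nra.
  have hu n : nrm (u n.+1 - u n) <= nrm (u 1%N - u 0%N) * (1 / 2) ^+ n.
    elim: n => [|n IH]; first by rewrite expr0 mulr1.
    by apply: le_trans (fB _ _) _; rewrite exprS; move: IH; lra.
  have [x hx _] := geometric_limit (nrm_ge0 _) hu; exists x.
  have fx : f x = x.
    apply: (@vconv_unique _ _ (fun n => u n.+1)); last first.
      by move=> e /hx[N hN]; exists N => n Nn; apply/hN/leqW.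
    move=> e /hx[N hN]; exists N => n /hN h /=; apply: le_trans (fB _ _) _.
    by have := nrm_ge0 (u n - x); lra.
  by rewrite -{1}fx /f scalerA mulfV // scale1r addrK.
have inj x y : z *: x - A x = z *: y - A y -> x = y.
  move=> h; have h2 : z *: (x - y) = A (x - y).
    move/eqP: h; rewrite subr_eq => /eqP h.
    by rewrite scalerBr h addrAC [_ - A y]addrC addrK addrC linearB.
  have h3 := A_le (x - y); rewrite -h2 nrmZ in h3; have h4 := nrm_ge0 (x - y).
  by apply/eqP; rewrite -subr_eq0; apply/eqP/nrm_eq0; nra.
have [g hg] := choice surj; exists g => // x.
by apply: inj; rewrite hg.
Qed.

Lemma not_in_spectrum z rho : spectral_radius A < rho -> rho <= cabs z -> ~ in_spectrum A z.
Proof.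
move=> hr hz hs; have : cabs z <= spectral_radius A.
  apply: ub_le_sup; last by exists z.
  by exists (2 * C + 1) => r [w [hw ->]]; apply: in_spectrum_bounded.
lra.
Qed.

End Spectrum.

(** * Green functions *)

Section GreenFunction.
Variables (R : realType) (V : completeNormedModType R[i]) (ip : V -> V -> R[i]).
Hypothesis hip : inner_product_of_norm ip.
Variables (A : {linear V -> V}) (C M : R).
Hypotheses (C_ge0 : 0 <= C) (A_le : forall x, nrm (A x) <= C * nrm x).
Hypotheses (M_ge0 : 0 <= M) (A_lb : lower_bound A 1 M).

(** Closing the orbit of [p] to an [n]-cycle leaves a single defect, [p - A^n p = x], at the last
    step. *)
Lemma cyclic_orbit_bound n p x : (0 < n)%N -> p - iter n A p = x ->
  \sum_(i < n) nrm (iter i A p) ^+ 2 <= (M * nrm x) ^+ 2.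
Proof.
move=> n0 hp; pose u i := if (i < n)%N then iter i A p else p.
have hu : u n = u 0%N by rewrite /u ltnn n0.
have := cyclic_bound hip n0 M_ge0 A_lb hu.
rewrite (eq_bigr (fun i : 'I_n => nrm (iter i A p) ^+ 2)); last by move=> i _; rewrite /u ltn_ord.
move/le_trans; apply; rewrite exprMn ler_wpM2l ?sqr_ge0 //.
case: n n0 hp @u hu => // n _ hp u hu.
rewrite big_ord_recr /= big1 ?add0r => [|i _].
  by rewrite /u ltnn ltnSn -iterS hp.
have -> : u i.+1 = A (u i) by rewrite /u !ltnS ltn_ord (ltnW (ltn_ord i)).
by rewrite subrr nrm0 expr0n.
Qed.

(** The [n]-periodic sequence [A^(k mod n) p] restricted to the window [j - n <= k < j]. *)
Definition cut_orbit n j (p : V) (k : int) : V :=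
  match k with
  | Posz i => if (i < j)%N then iter i A p else 0
  | Negz i => if (i < n - j)%N then iter (n - i.+1) A p else 0
  end.

(** The periodic orbit has its defect [x] between the indices [-1] and [0]. The cut adds two more,
    where the window opens at [j - n] and where it closes at [j], each of size [A^j p]. *)
Lemma tauA_cut_orbit n j p x k : (0 < j < n)%N -> p - iter n A p = x ->
  tauA A (cut_orbit n j p) k =
  delta (-1) x k + (delta (j%:Z - n%:Z - 1) (iter j A p) k - delta (j%:Z - 1) (iter j A p) k).
Proof.
move=> /andP[j0 jn] hp; rewrite /tauA /delta; case: k => [i|[|i]].
- have -> : Posz i + 1 = Posz i.+1 by lia.
  rewrite (_ : (Posz i == -1) = false) 1?(_ : (Posz i == j%:Z - n%:Z - 1) = false); try lia.
  rewrite /= !add0r; case: (ltngtP i.+1 j) => h.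
  + by rewrite subrr (_ : (Posz i == _) = false) ?oppr0 //; lia.
  + by rewrite linear0 subrr (_ : (Posz i == _) = false) ?oppr0 //; lia.
  + by rewrite -h (_ : (Posz i == _) = true) ?sub0r //; lia.
- rewrite (_ : Negz 0 + 1 = Posz 0) //= j0 subn_gt0 jn -iterS.
  rewrite (_ : (Negz 0 == j%:Z - n%:Z - 1) = false) 1?(_ : (Negz 0 == j%:Z - 1) = false); try lia.
  by rewrite subr0 addr0 subn1 prednK ?hp // (leq_trans _ jn).
rewrite NegzS_succ (_ : (Negz i.+1 == -1) = false) 1?(_ : (Negz i.+1 == j%:Z - 1) = false); try lia.
rewrite /= add0r subr0; case: (ltngtP i.+1 (n - j)) => h.
- rewrite -iterS (_ : (n - i.+2).+1 = (n - i.+1)%N) ?subrr; last by lia.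
  by rewrite (_ : (Negz i.+1 == _) = false) //; lia.
- by rewrite linear0 subrr (_ : (Negz i.+1 == _) = false) //; lia.
- rewrite linear0 subr0 (_ : (Negz i.+1 == _) = true); last by lia.
  by congr (iter _ A p); lia.
Qed.

Lemma in_cc_cut_orbit n j p : in_cc (cut_orbit n j p).
Proof.
by exists (n + j)%N => -[i|i] hi; rewrite /cut_orbit ifF //; apply/negbTE; rewrite -leqNgt; lia.
Qed.

Hypothesis resolvent_circle : forall z, cabs z = 1 -> forall x,
  z *: resolvent A z x - A (resolvent A z x) = x.

(* [riesz_sum A x N] generates a cyclic orbit of length [N + 1]; cutting it where it is
   smallest gives finitely supported approximate solutions of [tau h - A h = delta x]. *)
Lemma approx_green x N : exists v : int -> V, [/\ in_cc v, v 0 = riesz_sum A x N.+1 &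
  exists2 e, 0 <= e /\ N.+1%:R * e ^+ 2 <= (M * nrm x) ^+ 2 &
    l2bd 1 (fun k => tauA A v k - delta (-1) x k) (e + e)].
Proof.
(* The shift to [N.+1] makes the period [N + 2], leaving [N + 1 >= 1] interior positions for the
   cut. *)
set p := riesz_sum A x N.+1.
have hp : p - iter N.+2 A p = x.
  by apply: riesz_sum_inverse => z hz; exact: resolvent_circle.
have hs := cyclic_orbit_bound (ltn0Sn N.+1) hp.
have [j hj hmin] : exists2 j, (0 < j < N.+2)%N &
    N.+1%:R * nrm (iter j A p) ^+ 2 <= (M * nrm x) ^+ 2.
  apply: contrapT => hno; move: hs; rewrite leNgt => /negP; apply.
  have big i : (i < N.+1)%N -> (M * nrm x) ^+ 2 / N.+1%:R < nrm (iter i.+1 A p) ^+ 2.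
    move=> iN; rewrite ltr_pdivrMr ?ltr0n // ltNge; apply/negP => h.
    by apply: hno; exists i.+1; rewrite // mulrC.
  rewrite big_ord_recl /= (@lt_le_trans _ _ (\sum_(i < N.+1) nrm (iter i.+1 A p) ^+ 2)) //.
    have -> : (M * nrm x) ^+ 2 = \sum_(i < N.+1) (M * nrm x) ^+ 2 / N.+1%:R.
      by rewrite sumr_const card_ord -[RHS]mulr_natr divfK // pnatr_eq0.
    apply: ltr_sum => [|i _]; last exact: big.
    by apply/hasP; exists ord0; rewrite ?mem_index_enum.
  by rewrite lerDr sqr_ge0.
exists (cut_orbit N.+2 j p); split; first exact: in_cc_cut_orbit.
  by case/andP: hj => j0 _; rewrite /= j0.
exists (nrm (iter j A p)); first by split; [exact: nrm_ge0|].
apply: (l2bd_ext (v := fun k => delta (j%:Z - N.+2%:Z - 1) (iter j A p) k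
                             - delta (j%:Z - 1) (iter j A p) k)).
  by move=> k; rewrite (tauA_cut_orbit _ hj hp) addrC addKr.
apply: l2bdB; rewrite ?nrm_ge0 ?ltr01 //.
- by have := l2bd_delta (@ltr01 R) (j%:Z - N.+2%:Z - 1) (iter j A p); rewrite exp1rz mulr1.
- by have := l2bd_delta (@ltr01 R) (j%:Z - 1) (iter j A p); rewrite exp1rz mulr1.
Qed.

(** The defects of the approximate solutions decay like [(n + 1)^(-1/2)], so by the a priori bound
    they are Cauchy. Their entries at [0] are the Riemann sums, which therefore converge to
    [h 0]. *)
Lemma green x : exists h : int -> V, [/\ in_l2w 1 h,
  forall k, tauA A h k = delta (-1) x k & h 0 = riesz_plus A x].
Proof.
have [v hv] := choice (approx_green x).
have small e : 0 < e -> exists N, forall n, (N <= n)%N ->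
    l2bd 1 (fun k => tauA A (v n) k - delta (-1) x k) e.
  move=> e0; have e2 : 0 < (e / 2) ^+ 2 by rewrite exprn_gt0 // divr_gt0.
  exists (Num.truncn ((M * nrm x) ^+ 2 / (e / 2) ^+ 2)) => n hn.
  have [_ _ [d [d0 hd] h]] := hv n.
  apply: (l2bd_le _ _ h) => //; first by rewrite addr_ge0.
  have n1 : (M * nrm x) ^+ 2 / (e / 2) ^+ 2 < n.+1%:R.
    by apply: lt_le_trans (truncnS_gt _) _; rewrite ler_nat.
  suff : d <= e / 2 by lra.
  rewrite -(@ler_pXn2r _ 2) ?nnegrE ?divr_ge0 ?(ltW e0) //.
  rewrite -(ler_pM2l (ltr0Sn R n)); apply: le_trans hd _.
  by move: n1; rewrite ltr_pdivrMr // => /ltW.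
have vin n : in_l2w 1 (v n) by have [h _ _] := hv n; apply: in_l2w_cc.
have [|h hin hc] := l2_complete (@ltr01 R) vin.
  move=> e e0; have M1 : 0 < M + 1 by rewrite ltr_wpDl.
  have e2 : 0 < e / (M + 1) / 2 by rewrite !divr_gt0.
  have [N hN] := small _ e2; exists N => m n Nm Nn; set d := e / (M + 1).
  have d0 : 0 <= d by rewrite divr_ge0 // ltW.
  have hd : l2bd 1 (fun k => v m k - v n k) (M * d).
    apply: (apriori hip C_ge0 A_le) => //; first exact: in_l2wB.
    apply: (l2bd_ext (v := fun k => (tauA A (v m) k - delta (-1) x k) - (tauA A (v n) k - delta (-1) x k))).
      by move=> k; rewrite tauAB [in RHS]opprB [RHS]addrA subrK.
    have -> : d = d / 2 + d / 2 by field.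
    by apply: l2bdB; rewrite ?(ltW e2) //; apply: hN.
  apply: (l2bd_le _ _ hd) => //; first exact: mulr_ge0.
  by rewrite /d mulrA ler_pdivrMr // mulrC ler_pM2l // lerDl.
have hp k : vconv (fun n => v n k) (h k) by apply: (l2conv_point (@ltr01 R)).
exists h; split=> // [k|].
  apply: (vconv_unique (tauA_lim A_le k hp)) => e e0.
  have [N hN] := small _ e0; exists N => n /hN hn.
  by apply: le_trans (l2bd_point (@ltr01 R) k (ltW e0) hn) _; rewrite exp1rz mulr1.
(* [v n] carries [riesz_sum A x n.+1], so the threshold moves by one. *)
apply/esym/vconv_lim => e /(hp 0)[N hN]; exists N.+1 => -[//|n] hn.
by have [_ <- _] := hv n; apply: hN.
Qed.

End GreenFunction.

(** * Growth of the powers of [A] and summability of orbits *)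

Lemma geometric_sum_le (R : realType) (q : R) n : 0 <= q < 1 -> \sum_(i < n) q ^+ i <= (1 - q)^-1.
Proof.
move=> /andP[q0 q1]; have q2 : 0 < 1 - q by rewrite subr_gt0.
rewrite -[X in _ <= X]mul1r ler_pdivlMr // mulrC -opprB mulNr -subrX1 opprB.
by rewrite gerBl exprn_ge0.
Qed.

Lemma bernoulli_sub (R : realType) (a : R) m : 0 <= a <= 1 -> 1 - m%:R * a <= (1 - a) ^+ m.
Proof.
move=> /andP[a0 a1]; elim: m => [|m IH]; first by rewrite mul0r subr0.
rewrite exprS -natr1 mulrDl mul1r; have m0 : 0 <= m%:R :> R by rewrite ler0n.
have : 0 <= m%:R * a * a by rewrite !mulr_ge0.
have : 0 <= (1 - a) * ((1 - a) ^+ m - (1 - m%:R * a)) by rewrite mulr_ge0 ?subr_ge0.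
lra.
Qed.

Section PowerBound.
Variables (R : realType) (V : completeNormedModType R[i]) (A : {linear V -> V}).

Definition power_bounded (t : R) :=
  exists2 D : R, 0 <= D & forall n x, nrm (iter n A x) <= D * t ^+ n * nrm x.

Definition forward_orbit (x : V) (k : int) : V := if k is Posz i then iter i A x else 0.

Lemma tauA_forward_orbit x k : tauA A (forward_orbit x) k = delta (-1) x k.
Proof.
rewrite /tauA /delta; case: k => [i|[|i]].
- have -> : Posz i + 1 = Posz i.+1 by lia.
  by rewrite /= subrr.
- by rewrite (_ : Negz 0 + 1 = Posz 0) //= linear0 subr0.
- by rewrite NegzS_succ /= linear0 subr0.
Qed.

Lemma en_forward_orbit s x n :
  en s (forward_orbit x) 0 n = \sum_(i < n) (nrm (iter i A x) * s ^- i) ^+ 2.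
Proof.
apply: eq_bigr => i _; rewrite add0r /wterm /= exprMn; congr (_ * _).
by rewrite exprnN exprz_sqr mulrN.
Qed.

Lemma in_l2w_forward_orbit t s x : 0 < t < s -> power_bounded t ->
  in_l2w s (forward_orbit x).
Proof.
move=> /andP[t0 ts] [D D0 hD]; have s0 := lt_trans t0 ts.
pose q := (t / s) ^+ 2.
have q01 : 0 <= q < 1.
  by rewrite /q sqr_ge0 /= exprn_ilt1 ?divr_ge0 ?ltW // ltr_pdivrMr // mul1r.
have q2 : 0 <= (1 - q)^-1 by rewrite invr_ge0 subr_ge0 ltW //; case/andP: q01.
pose B := (D * nrm x) ^+ 2 * (1 - q)^-1; have B0 : 0 <= B by rewrite mulr_ge0 ?sqr_ge0.
apply: (@l2bd_in _ _ _ s0 _ (Num.sqrt B)); apply: l2bd_sym => // K; exists K => //.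
rewrite sqr_sqrtr // en_cat (en_zero s0) ?add0r; last first.
  by move=> -[i|i] //= hi; lia.
rewrite addNr en_forward_orbit.
apply: (@le_trans _ _ (\sum_(i < K) (D * nrm x) ^+ 2 * q ^+ i)).
  apply: ler_sum => i _; rewrite /q -exprM mulnC exprM -exprMn.
  rewrite ler_pXn2r // ?nnegrE ?mulr_ge0 ?nrm_ge0 ?invr_ge0 ?exprn_ge0 ?divr_ge0 ?(ltW s0) ?(ltW t0) //.
  rewrite expr_div_n mulrA ler_wpM2r ?invr_ge0 ?exprn_ge0 ?(ltW s0) //.
  by rewrite mulrAC; apply: hD.
by rewrite -mulr_sumr ler_wpM2l ?sqr_ge0 // geometric_sum_le.
Qed.

Variables (ip : V -> V -> R[i]) (C : R).
Hypothesis hip : inner_product_of_norm ip.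
Hypotheses (C_ge0 : 0 <= C) (A_le : forall x, nrm (A x) <= C * nrm x).

(* Datko's argument: square summability of every orbit, applied to [A^i x] and then to [x],
   forces [|A^n x| / s^n] to decay like [(n + 1)^(-1/2)] *)
Lemma orbit_decay s M n x : 0 < s -> 0 <= M -> lower_bound A s M ->
  (forall y, in_l2w s (forward_orbit y)) ->
  n.+1%:R * (nrm (iter n A x) * s ^- n) ^+ 2 <= ((M * s) ^+ 2 * nrm x) ^+ 2.
Proof.
move=> s0 M0 lb hin; pose K := M * s; have K0 : 0 <= K by rewrite mulr_ge0 // ltW.
have bd y : l2bd s (forward_orbit y) (K * nrm y).
  have -> : K * nrm y = M * (nrm y * s ^ (- -1)) by rewrite opprK expr1z /K; ring.
  apply: (apriori hip C_ge0 A_le) => //; first by rewrite mulr_ge0 ?nrm_ge0 ?exprz_ge0 ?ltW.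
  apply: (l2bd_ext (v := delta (-1) y)) => [k|]; first exact: tauA_forward_orbit.
  exact: l2bd_delta.
have pt i y : nrm (iter i A y) * s ^- i <= K * nrm y.
  have := l2bd_point s0 i _ (bd y); rewrite /= mulr_ge0 ?nrm_ge0 // => /(_ isT).
  by rewrite ler_pdivrMr ?exprn_gt0.
have -> : n.+1%:R * (nrm (iter n A x) * s ^- n) ^+ 2 =
    \sum_(i < n.+1) (nrm (iter n A x) * s ^- n) ^+ 2.
  by rewrite sumr_const card_ord mulr_natl.
apply: (@le_trans _ _ (\sum_(i < n.+1) K ^+ 2 * (nrm (iter i A x) * s ^- i) ^+ 2)).
  apply: ler_sum => i _; have hi : (i <= n)%N by rewrite -ltnS.
  rewrite -exprMn ler_pXn2r // ?nnegrE ?mulr_ge0 ?nrm_ge0 ?invr_ge0 ?exprn_ge0 ?(ltW s0) //.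
  have := pt (n - i)%N (iter i A x); rewrite -iterD subnK // => h.
  rewrite -[X in s ^- X](subnK hi) exprD invfM mulrA [X in _ <= X]mulrA.
  by rewrite ler_wpM2r ?invr_ge0 ?exprn_ge0 ?(ltW s0).
rewrite -mulr_sumr -en_forward_orbit; have := bd x 0 n.+1.
have -> : ((M * s) ^+ 2 * nrm x) ^+ 2 = K ^+ 2 * (K * nrm x) ^+ 2 by rewrite /K; ring.
by apply: ler_wpM2l; rewrite sqr_ge0.
Qed.

(** Division of [n] by [m]: each full block costs [r^m], and the remainder at most the factor
    [(1 + C / r)^m]. *)
Lemma power_boundedP r m : 0 < r -> (0 < m)%N ->
  (forall x, nrm (iter m A x) <= r ^+ m * nrm x) -> power_bounded r.
Proof.
move=> r0 m0 hm; pose D := (1 + C / r) ^+ m.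
have c0 : 0 <= C / r by rewrite divr_ge0 // ltW.
have c1 : 1 <= 1 + C / r by rewrite lerDl.
have it n x : nrm (iter n A x) <= C ^+ n * nrm x.
  elim: n => [|n IH]; first by rewrite mul1r.
  rewrite exprS -mulrA; apply: le_trans (A_le _) _; exact: ler_wpM2l.
exists D => [|n x]; first by rewrite exprn_ge0 // (le_trans ler01).
elim/ltn_ind: n => n IH; case: (ltnP n m) => nm.
  apply: le_trans (it n x) _; rewrite ler_wpM2r ?nrm_ge0 //.
  rewrite -ler_pdivrMr ?exprn_gt0 // -expr_div_n.
  apply: (@le_trans _ _ ((1 + C / r) ^+ n)).
    by apply: lerXn2r; rewrite ?nnegrE //; lra.
  by rewrite ler_weXn2l // ltnW.
rewrite -(subnKC nm) iterD; apply: le_trans (hm _) _.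
have := IH (n - m)%N; rewrite ltn_subrL m0 (leq_trans m0 nm) => /(_ isT) h.
rewrite exprD [D * _]mulrCA -mulrA; apply: ler_wpM2l => //.
by rewrite exprn_ge0 // ltW.
Qed.

(* Starting from a large radius, the bound on the resolvents over the annulus lets the radius
   of power boundedness shrink by a fixed factor as long as it exceeds [rho]. *)
Lemma power_bounded_below_rho rho : 0 < rho ->
  (forall z, rho <= cabs z -> ~ in_spectrum A z) ->
  exists2 t, 0 < t < rho & power_bounded t.
Proof.
move=> rho0 hspec; pose L := 2 * C + rho + 1.
have [|M M0 hM] := annulus_lb A_le (r1 := rho) (r2 := L).
  by move=> z /andP[h _]; apply: hspec.
have C0 := C_ge0; pose K := M * L; have L0 : 0 < L by rewrite /L; lra.
have K0 : 0 <= K by rewrite mulr_ge0 // ltW.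
(* With [4 K^4 <= m + 1] the decay of [orbit_decay] becomes a halving, [|A^m x| <= s^m |x| / 2]. *)
pose m := (Num.truncn (4 * K ^+ 4)).+1; have m0 : 0 < m%:R :> R by rewrite ltr0n.
have mK : 4 * K ^+ 4 <= m.+1%:R.
  by apply/ltW/(lt_trans (truncnS_gt _)); rewrite ltr_nat.
(* By Bernoulli [c^m >= 3/4], hence [c^(2m) >= 1/2]; for [t = c s] this gives
   [s^m / 2 <= (c t)^m]. *)
pose a : R := (4 * m%:R)^-1; pose c := 1 - a.
have a0 : 0 < a by rewrite invr_gt0 mulr_gt0.
have m1 : 1 <= m%:R :> R by rewrite ler1n.
have am : m%:R * a = 1 / 4 by rewrite /a; field; rewrite gt_eqF.
have a4 : a <= 1 / 4 by nra.
have c0 : 0 < c by rewrite /c; lra.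
have c1 : c < 1 by rewrite /c; lra.
have cm : 1 / 2 <= (c ^+ 2) ^+ m.
  rewrite -exprM mulnC exprM.
  have : 1 - m%:R * a <= c ^+ m by apply: bernoulli_sub; lra.
  by rewrite am => h; nra.
have step t : power_bounded t -> c * rho <= t <= c * L -> power_bounded (c * t).
  move=> ht /andP[h1 h2]; have t0 : 0 < t by apply: lt_le_trans h1; rewrite mulr_gt0.
  (* [s] exceeds [t], so orbits are square summable in weight [s], and it lies in the annulus where
     [M] bounds the resolvents. *)
  pose s := t / c; have ts : t = c * s by rewrite mulrC divfK // gt_eqF.
  have s0 : 0 < s by rewrite divr_gt0.
  have s1 : rho <= s by rewrite ler_pdivlMr // mulrC.
  have s2 : s <= L by rewrite ler_pdivrMr // mulrC.
  apply: (@power_boundedP _ m); rewrite ?mulr_gt0 // => x.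
  have lb : lower_bound A s M by move=> z hz; apply: hM; rewrite hz s1.
  have hin y : in_l2w s (forward_orbit y).
    by apply: (@in_l2w_forward_orbit t) => //; rewrite t0 /= ts gtr_pMl.
  have h := orbit_decay m x s0 (ltW M0) lb hin.
  have sm : 0 < s ^+ m by rewrite exprn_gt0.
  suff hh : nrm (iter m A x) * s ^- m <= nrm x / 2.
    rewrite ler_pdivrMr // in hh; apply: le_trans hh _.
    have -> : (c * t) ^+ m = (c ^+ 2) ^+ m * s ^+ m by rewrite [in LHS]ts mulrA -expr2 exprMn.
    have : 0 <= ((c ^+ 2) ^+ m - 1 / 2) * (s ^+ m * nrm x).
      by rewrite !mulr_ge0 ?subr_ge0 ?nrm_ge0 ?(ltW sm).
    lra.
  have x0 := nrm_ge0 x.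
  rewrite -(@ler_pXn2r _ 2) ?nnegrE ?mulr_ge0 ?nrm_ge0 ?invr_ge0 ?(ltW sm) //.
  have k4 : ((M * s) ^+ 2 * nrm x) ^+ 2 <= K ^+ 4 * nrm x ^+ 2.
    have Ms : 0 <= M * s by apply: mulr_ge0; exact: ltW.
    rewrite exprMn -exprM; apply: ler_wpM2r; first exact: sqr_ge0.
    by apply: lerXn2r; rewrite ?nnegrE // ler_wpM2l // ltW.
  set y := (_ * _) ^+ 2 in h *; have y0 : 0 <= y by rewrite sqr_ge0.
  have x2 : 0 <= nrm x ^+ 2 by rewrite sqr_ge0.
  have -> : (nrm x / 2) ^+ 2 = nrm x ^+ 2 / 4 by field.
  have k5 := le_trans h k4; have m2 : 0 < m.+1%:R :> R by rewrite ltr0n.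
  rewrite -(ler_pM2l m2); apply: (le_trans k5).
  have : 0 <= nrm x ^+ 2 * (m.+1%:R - 4 * K ^+ 4) by rewrite mulr_ge0 ?subr_ge0.
  lra.
(* The descent starts at [c L], which exceeds [C] because [c >= 3/4]; at each stage it goes on or
   has already passed below [rho]. *)
have it j : power_bounded (c * L * c ^+ j) \/ exists2 t, 0 < t < rho & power_bounded t.
  elim: j => [|j [IH|IH]]; last by right.
    left; rewrite mulr1; apply: (@power_boundedP _ 1); rewrite ?mulr_gt0 // => x.
    apply: le_trans (A_le x) _; rewrite ler_wpM2r ?nrm_ge0 // expr1 /c /L.
    have : 0 <= (2 * C + rho + 1) * (1 / 4 - a) by rewrite mulr_ge0 //; lra.
    by have := rho0; have := C_ge0; lra.
  case: (ltP (c * L * c ^+ j) rho) => h.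
    by right; exists (c * L * c ^+ j) => //; rewrite h !mulr_gt0 ?exprn_gt0.
  left; rewrite exprS mulrCA; apply: step => //; apply/andP; split.
    by apply: le_trans h; rewrite ger_pMl // ltW.
  by rewrite ger_pMr ?mulr_gt0 // exprn_ile1 // ltW.
have [||||N hN] := @geo_small _ (c * L) c (rho / 2); rewrite ?mulr_ge0 ?(ltW c0) ?(ltW L0) ?divr_gt0 //.
have [h|//] := it N; exists (c * L * c ^+ N) => //.
rewrite !mulr_gt0 ?exprn_gt0 //=; have := hN N (leqnn N); lra.
Qed.

End PowerBound.

(** * Fixed points *)

Section Picard.
Variables (R : realType) (V : completeNormedModType R[i]) (gamma q : R).
Hypotheses (gamma_gt0 : 0 < gamma) (q_ge0 : 0 <= q) (q_lt1 : q < 1).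
Variable Phi : (int -> V) -> int -> V.
Hypothesis contracting : forall u v c, in_l2w gamma u -> in_l2w gamma v -> 0 <= c ->
  l2bd gamma (fun k => u k - v k) c -> l2bd gamma (fun k => Phi u k - Phi v k) (q * c).

Lemma contraction_unique u v : in_l2w gamma u -> in_l2w gamma v ->
  Phi u = u -> Phi v = v -> u = v.
Proof.
move=> hu hv fu fv; set w := fun k => u k - v k.
have hw : in_l2w gamma w by apply: in_l2wB.
have n0 := l2w_norm_ge0 gamma w; have hn := l2bd_norm gamma_gt0 hw.
have := contracting hu hv n0 hn; rewrite fu fv => /l2w_norm_le.
rewrite mulr_ge0 // -/w => /(_ gamma_gt0 isT) h.
have e0 : l2w_norm gamma w = 0.
  apply/eqP; have := q_lt1; rewrite eq_le n0 andbT; nra.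
apply/funext => k; apply/eqP; rewrite -subr_eq0; apply/eqP.
by rewrite e0 in hn; exact: (l2bd_le0 gamma_gt0 k hn).
Qed.

Variable D : (int -> V) -> Prop.
Hypothesis D0 : D (fun=> 0).
Hypothesis stable : forall u, in_l2w gamma u -> D u -> in_l2w gamma (Phi u) /\ D (Phi u).
Hypothesis closedD : forall (u_ : nat -> int -> V) u, (forall n, D (u_ n)) ->
  (forall k, vconv (fun n => u_ n k) (u k)) -> D u.

(** Picard iteration from zero. The property [D] is carried along to the fixed point; it serves to
    keep supports in [k >= 0]. *)
Lemma contraction_fixed_point : exists u, [/\ in_l2w gamma u, D u & Phi u = u].
Proof.
pose u := fix u n := if n is m.+1 then Phi (u m) else fun=> 0.
have hu n : in_l2w gamma (u n) /\ D (u n).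
  elim: n => [|n [IH1 IH2]]; last exact: stable.
  by split=> //; exact: (l2bd_in gamma_gt0 (l2bd0 V gamma_gt0)).
have [a a0 ha] : exists2 a, 0 <= a & l2bd gamma (fun k => u 1%N k - u 0%N k) a.
  by apply/(in_l2wP gamma_gt0)/in_l2wB => //; exact: (hu _).1.
have step n : l2bd gamma (fun k => u n.+1 k - u n k) (a * q ^+ n).
  elim: n => [|n IH]; first by rewrite mulr1.
  rewrite exprS mulrCA; apply: contracting IH; try exact: (hu _).1.
  by rewrite mulr_ge0 ?exprn_ge0.
have q1 : 0 < 1 - q by rewrite subr_gt0.
pose b := a / (1 - q); have b0 : 0 <= b by rewrite divr_ge0 // ltW.
have ab : a = b * (1 - q) by rewrite divfK // gt_eqF.
(* Again an exact partial geometric sum, with [b = a / (1 - q)]. *)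
have far n k : l2bd gamma (fun j => u (n + k)%N j - u n j) (b * q ^+ n * (1 - q ^+ k)).
  elim: k => [|k IH].
    rewrite addn0 subrr mulr0; apply: (l2bd_ext (v := fun=> 0)); last exact: l2bd0.
    by move=> j; rewrite subrr.
  have -> : b * q ^+ n * (1 - q ^+ k.+1) = a * q ^+ (n + k) + b * q ^+ n * (1 - q ^+ k).
    by rewrite ab exprD exprS; ring.
  apply: (l2bd_ext (v := fun j => (u (n + k).+1 j - u (n + k)%N j) + (u (n + k)%N j - u n j))).
    by move=> j; rewrite addnS addrA subrK.
  apply: l2bdD => //; first by rewrite mulr_ge0 ?exprn_ge0.
  have qk : 0 <= 1 - q ^+ k by rewrite subr_ge0 exprn_ile1 // ltW.
  by apply: mulr_ge0 => //; rewrite mulr_ge0 ?exprn_ge0.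
have far' n m : (n <= m)%N -> l2bd gamma (fun j => u m j - u n j) (b * q ^+ n).
  move=> nm; have := far n (m - n)%N; rewrite subnKC // => h.
  have qk : 0 <= q ^+ (m - n) <= 1 by rewrite exprn_ge0 // exprn_ile1 // ltW.
  have bq : 0 <= b * q ^+ n by rewrite mulr_ge0 ?exprn_ge0.
  by apply: (l2bd_le _ _ h); [rewrite mulr_ge0 // subr_ge0; case/andP: qk|rewrite ler_piMr //; lra].
have [|e e0|v hv cv] := l2_complete gamma_gt0 (u_ := u).
- by move=> n; exact: (hu n).1.
- have [||||N hN] := @geo_small _ b q (e / 2); rewrite ?divr_gt0 //.
  exists N => m n Nm Nn; have hNN := hN N (leqnn N).
  have bq : 0 <= b * q ^+ N by rewrite mulr_ge0 ?exprn_ge0.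
  apply: (@l2bd_le _ _ _ _ (b * q ^+ N + b * q ^+ N)); [lra|lra|].
  apply: (l2bd_ext (v := fun j => (u m j - u N j) - (u n j - u N j))).
    by move=> j; rewrite [in RHS]opprB [RHS]addrA subrK.
  by apply: l2bdB => //; apply: far'.
exists v; split=> //.
  by apply: (closedD (fun n => (hu n).2)) => k; exact: (l2conv_point gamma_gt0 k cv).
apply/funext => k; apply: (@vconv_unique _ _ (fun n => u n.+1 k)); last first.
  by move=> e e0; have [N hN] := l2conv_point gamma_gt0 k cv e0; exists N => n Nn; apply/hN/leqW.
apply: (l2conv_point gamma_gt0 (u_ := fun n => Phi (u n)) k) => e e0; have [N hN] := cv e e0; exists N => n /hN h.
apply: (@l2bd_le _ _ _ _ (q * e)); rewrite ?mulr_ge0 ?ler_piMl ?(ltW e0) ?(ltW q_lt1) //.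
by apply: contracting => //; [exact: (hu n).1|exact: ltW].
Qed.

End Picard.

(** * Lipschitz extensions, forward supports and the inverse of [tau - A] *)

Section Extension.
Variables (R : realType) (V : completeNormedModType R[i]).
Variables (gamma L : R) (F G : (int -> V) -> int -> V).
Hypotheses (gamma_gt0 : 0 < gamma) (hG : lipschitz_extension gamma F G L).

Lemma lipschitz_l2bd u v c : in_l2w gamma u -> in_l2w gamma v -> 0 <= c ->
  l2bd gamma (fun k => u k - v k) c -> l2bd gamma (fun k => G u k - G v k) (L * c).
Proof.
case: hG => [Gin _ L0 lip] hu hv c0 h.
apply: (l2bd_le _ _ (l2bd_norm gamma_gt0 (in_l2wB gamma_gt0 (Gin _ hu) (Gin _ hv)))).
  exact: l2w_norm_ge0.
by apply: le_trans (lip _ _ hu hv) _; apply: ler_wpM2l => //; exact: l2w_norm_le.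
Qed.

(** An extension is determined entrywise by [F] on truncations, whatever the weight. Hence
    extensions for two weights agree on common sequences, and causality passes to them. *)
Lemma extension_lim u k : in_l2w gamma u -> vconv (fun n => F (trunc n u) k) (G u k).
Proof.
move=> hu; have [_ GF L0 _] := hG.
have -> : (fun n => F (trunc n u) k) = (fun n => G (trunc n u) k).
  by apply/funext => n; rewrite GF //; exact: in_cc_trunc.
apply: (l2conv_point gamma_gt0 (u_ := fun n => G (trunc n u)) k) => e e0; have L1 : 0 < L + 1 by rewrite ltr_wpDl.
have [N hN] := l2bd_trunc gamma_gt0 hu (divr_gt0 e0 L1); exists N => n /hN h.
have d0 : 0 <= e / (L + 1) by rewrite divr_ge0 ?ltW.
have h2 : l2bd gamma (fun k => G (trunc n u) k - G u k) (L * (e / (L + 1))).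
  apply: lipschitz_l2bd => //; last exact: l2bdN.
  by apply: in_l2w_cc => //; exact: in_cc_trunc.
apply: (l2bd_le _ _ h2); first exact: mulr_ge0.
by rewrite mulrA ler_pdivrMr // mulrC ler_pM2l // lerDl.
Qed.

Lemma extension_causal u : causal F -> F (fun=> 0) = (fun=> 0) -> in_l2w gamma u ->
  (forall k, k < 0 -> u k = 0) -> forall k, k < 0 -> G u k = 0.
Proof.
move=> hc F0 hu u0 k k0; apply: (vconv_unique (extension_lim k hu)).
have -> : (fun n => F (trunc n u) k) = (fun=> 0); last exact: vconv_cst.
apply/funext => n; rewrite (hc _ (fun=> 0) 0) ?F0 //; first exact: in_cc_trunc.
  by exists 0%N.
by move=> j j0; rewrite /trunc u0 // if_same.
Qed.

End Extension.

Section ForwardSupport.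
Variables (R : realType) (V : completeNormedModType R[i]).

Lemma chi_nonneg_le (u v : int -> V) k :
  nrm (chi_nonneg u k - chi_nonneg v k) <= 1 * nrm (u k - v k).
Proof. by rewrite mul1r /chi_nonneg; case: ifP => // _; rewrite subrr nrm0 nrm_ge0. Qed.

Lemma in_l2w_chi (gamma : R) (u : int -> V) : 0 < gamma -> in_l2w gamma u ->
  in_l2w gamma (chi_nonneg u).
Proof.
move=> g0; apply: (in_l2w_dom g0 ler01) => k.
by rewrite mul1r /chi_nonneg; case: ifP => // _; rewrite nrm0 nrm_ge0.
Qed.

(** For [k >= 0] the weight [gamma^(-2k)] decreases in [gamma]. *)
Lemma in_l2w_mono (gamma d : R) (u : int -> V) : 0 < gamma -> gamma <= d ->
  (forall k, k < 0 -> u k = 0) -> in_l2w gamma u -> in_l2w d u.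
Proof.
move=> g0 gd u0 /(in_l2wP g0)[c c0 hc]; have d0 := lt_le_trans g0 gd.
apply/(in_l2wP d0); exists c => // a n; apply: le_trans (hc a n).
apply: ler_sum => i _; rewrite /wterm; case: (ltP (a + i%:Z) 0) => h.
  by rewrite u0 // nrm0 expr0n !mul0r.
rewrite ler_wpM2l ?sqr_ge0 //; case: (a + i%:Z) h => // m _.
rewrite (_ : 2 * Posz m = (2 * m)%N%:Z) // -!exprnN lef_pV2 ?posrE ?exprn_gt0 //.
by apply: lerXn2r => //; rewrite nnegrE ltW.
Qed.

End ForwardSupport.

Section SolutionOperator.
Variables (R : realType) (V : completeNormedModType R[i]) (ip : V -> V -> R[i]).
Hypothesis hip : inner_product_of_norm ip.
Variables (A : {linear V -> V}) (C gamma M : R).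
Hypotheses (C_ge0 : 0 <= C) (A_le : forall x, nrm (A x) <= C * nrm x).
Hypotheses (gamma_gt0 : 0 < gamma) (M_ge0 : 0 <= M) (A_lb : lower_bound A gamma M).
Hypothesis has_green :
  forall x, exists2 h, in_l2w gamma h & forall k, tauA A h k = delta (-1) x k.

(** [S] is [(tau - A)^-1] on the weighted space, made a total function with unconstrained values
    elsewhere. The a priori bound gives its Lipschitz constant. *)
Lemma solution_operator : exists S : (int -> V) -> int -> V,
  [/\ forall g, in_l2w gamma g -> in_l2w gamma (S g),
      forall g, in_l2w gamma g -> forall k, tauA A (S g) k = g k
    & forall f g c, in_l2w gamma f -> in_l2w gamma g -> 0 <= c ->
        l2bd gamma (fun k => f k - g k) c -> l2bd gamma (fun k => S f k - S g k) (M * c)].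
Proof.
have /choice[S hS] : forall g, exists u, in_l2w gamma g ->
    in_l2w gamma u /\ forall k, tauA A u k = g k.
  move=> g; have [hg|hg] := pselect (in_l2w gamma g); last by exists (fun=> 0).
  have [u hu ue] := tauA_surj hip C_ge0 A_le gamma_gt0 M_ge0 A_lb has_green hg.
  by exists u.
exists S; split=> [g /hS[]//|g /hS[]//|f g c hf hg c0 h].
have [f1 f2] := hS f hf; have [g1 g2] := hS g hg.
apply: (apriori hip C_ge0 A_le) => //; first exact: in_l2wB.
by apply: (l2bd_ext (v := fun k => f k - g k)) => // k; rewrite tauAB f2 g2.
Qed.

End SolutionOperator.

(** * The Riesz projection *)

Section RieszProjection.
Variables (R : realType) (V : completeNormedModType R[i]) (ip : V -> V -> R[i]).
Hypothesis hip : inner_product_of_norm ip.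
Variables (A : {linear V -> V}) (C M : R).
Hypotheses (C_ge0 : 0 <= C) (A_le : forall x, nrm (A x) <= C * nrm x).
Hypotheses (M_ge0 : 0 <= M) (A_lb : lower_bound A 1 M).
Hypothesis resolvent_circle : forall z, cabs z = 1 -> forall x,
  z *: resolvent A z x - A (resolvent A z x) = x.

Local Notation P := (riesz_plus A).
Let gt01 : 0 < 1 :> R := ltr01.

(** Uniqueness of the Green function: properties of [P] now follow by exhibiting solutions in [l_2]
    and reading their entry at [0]. *)
Lemma riesz_plusE x h : in_l2w 1 h -> (forall k, tauA A h k = delta (-1) x k) -> P x = h 0.
Proof.
move=> hin he; have [g [gin ge <-]] := green hip C_ge0 A_le M_ge0 A_lb resolvent_circle x.
congr (_ 0); apply: (tauA_inj hip C_ge0 A_le gt01 M_ge0 A_lb) => // k.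
by rewrite ge he.
Qed.

Lemma green_forward x h n : in_l2w 1 h -> (forall k, tauA A h k = delta (-1) x k) ->
  h (Posz n) = iter n A (P x).
Proof.
move=> hin he; elim: n => [|n IH]; first by rewrite (riesz_plusE hin he).
have := he (Posz n); rewrite /tauA (_ : Posz n + 1 = Posz n.+1); last by lia.
by rewrite /delta IH => /eqP; rewrite subr_eq0 => /eqP.
Qed.

Lemma riesz_plusB x y : P (x - y) = P x - P y.
Proof.
have [g [gin ge <-]] := green hip C_ge0 A_le M_ge0 A_lb resolvent_circle x.
have [h [hin he <-]] := green hip C_ge0 A_le M_ge0 A_lb resolvent_circle y.
apply: (riesz_plusE (h := fun k => g k - h k)); first exact: in_l2wB.
by move=> k; rewrite tauAB ge he /delta; case: ifP => // _; rewrite subrr.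
Qed.

Lemma riesz_plusA x : P (A x) = A (P x).
Proof.
have [g [gin ge <-]] := green hip C_ge0 A_le M_ge0 A_lb resolvent_circle x.
apply: (riesz_plusE (h := fun k => A (g k))).
  exact: (in_l2w_dom gt01 C_ge0 (fun k => A_le (g k)) gin).
by move=> k; rewrite /tauA -linearB -/(tauA A g k) ge /delta; case: ifP => // _; rewrite linear0.
Qed.

Lemma riesz_plus_iter n x : P (iter n A x) = iter n A (P x).
Proof. by elim: n => //= n IH; rewrite riesz_plusA IH. Qed.

(** The part on [k >= 0] of the Green function of [x] is the forward orbit of [P x], which is itself
    the Green function of [P x]. *)
Lemma riesz_plus_idem x : P (P x) = P x.
Proof.
have [g [gin ge _]] := green hip C_ge0 A_le M_ge0 A_lb resolvent_circle x.
apply: (riesz_plusE (h := forward_orbit A (P x))); last exact: tauA_forward_orbit.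
have -> : forward_orbit A (P x) = chi_nonneg g.
  by apply/funext => -[n|n] //; rewrite /chi_nonneg /= (green_forward n gin ge).
exact: in_l2w_chi.
Qed.

(** [A^n (P x)] is the entry at [n] of the Green function of [x], whose norm is at most
    [M nrm x]. *)
Lemma riesz_plus_power_bound n x : nrm (iter n A (P x)) <= M * nrm x.
Proof.
have [g [gin ge _]] := green hip C_ge0 A_le M_ge0 A_lb resolvent_circle x.
have hg : l2bd 1 g (M * nrm x).
  apply: (apriori hip C_ge0 A_le) => //; first exact: nrm_ge0.
  apply: (l2bd_ext ge); have := l2bd_delta gt01 (-1) x.
  by rewrite exp1rz mulr1.
have := l2bd_point gt01 (Posz n) _ hg; rewrite (green_forward n gin ge) exp1rz mulr1.
by apply; rewrite mulr_ge0 ?nrm_ge0.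
Qed.

(* A bounded backward orbit has no component in the range of [P], on which the forward
   powers of [A] are uniformly bounded. *)
Lemma riesz_plus_backward g : in_l2w 1 g -> (forall k, k < -1 -> g (k + 1) = A (g k)) ->
  P (g (-1)) = 0.
Proof.
move=> gin hg.
have back n : g (-1) = iter n A (g (- n.+1%:Z)).
  elim: n => // n ->; rewrite iterSr; congr (iter n A _).
  by rewrite -hg; [congr g; lia|lia].
apply: nrm_le0 => e e0; have M1 : 0 < M + 1 by rewrite ltr_wpDl.
have [N hN] := l2bd_trunc gt01 gin (divr_gt0 e0 M1).
rewrite (back N) riesz_plus_iter; apply: le_trans (riesz_plus_power_bound _ _) _.
have := l2bd_point gt01 (- N.+1%:Z) _ (hN N (leqnn N)).
rewrite /trunc ifF ?subr0; last by apply/negbTE; rewrite negb_and -!ltNge; lia.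
rewrite exp1rz mulr1 divr_ge0 ?(ltW e0) ?(ltW M1) // => /(_ isT) h.
apply: (@le_trans _ _ (M * (e / (M + 1)))); first exact: ler_wpM2l.
by rewrite mulrA ler_pdivrMr // mulrC ler_pM2l // lerDl.
Qed.

End RieszProjection.

(** For [k < 0] the entry is [u k = A^n (u (k - n))] for all [n]; growth [t^n] of the powers against
    [rho^(k - n)] for the entries leaves a factor [(t / rho)^n]. *)
Lemma forward_support (R : realType) (V : completeNormedModType R[i]) (A : {linear V -> V})
    (t rho : R) (u : int -> V) :
  0 < t < rho -> power_bounded A t -> in_l2w rho u ->
  (forall k, k < -1 -> tauA A u k = 0) -> forall k, k < 0 -> u k = 0.
Proof.
move=> /andP[t0 trho] [D D0 hD] hu he k k0.
have r0 := lt_trans t0 trho; have [c c0 hc] := (in_l2wP r0 u).1 hu.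
have back n : u k = iter n A (u (k - n%:Z)).
  elim: n => [|n IH]; first by rewrite subr0.
  rewrite iterSr {1}IH; congr (iter n A _).
  have := he (k - n.+1%:Z); rewrite /tauA => /(_ _)/eqP; rewrite subr_eq0.
  have -> : k - n.+1%:Z + 1 = k - n%:Z by lia.
  by move=> h; apply/eqP/h; lia.
apply: nrm_le0 => e e0; have rk : 0 < rho ^ k by rewrite exprz_gt0.
have [||||N hN] := @geo_small _ (D * c * rho ^ k) (t / rho) e.
- by rewrite !mulr_ge0 // ltW.
- by rewrite divr_ge0 // ltW.
- by rewrite ltr_pdivrMr // mul1r.
- by [].
apply: le_trans (hN N (leqnn N)); rewrite {1}(back N).
apply: le_trans (hD _ _) _.
apply: (@le_trans _ _ (D * t ^+ N * (c * rho ^ (k - N%:Z)))).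
  by rewrite ler_wpM2l ?mulr_ge0 ?exprn_ge0 ?(ltW t0) // l2bd_point.
rewrite expfzDr ?gt_eqF // -exprnN expr_div_n le_eqVlt; apply/orP; left.
by apply/eqP; ring.
Qed.

Lemma continuous_linear_bounded (R : realType) (V : normedModType R[i]) (A : {linear V -> V}) :
  continuous A -> exists2 C : R, 0 <= C & forall x, nrm (A x) <= C * nrm x.
Proof.
move=> /(_ 0)/cvgrPdist_le/(_ 1 ltr01)/nbhs_ballP[d /posC[]]; set r := complex.Re d => r0 -> hr.
exists (2 / r) => [|x]; first by rewrite divr_ge0 // ltW.
have [->|x0] := eqVneq x 0; first by rewrite linear0 nrm0 mulr0.
have xp := nrm_gt0 x0; pose c := r / 2 / nrm x.
have c0 : 0 < c by rewrite !divr_gt0.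
have := hr (c%:C%C *: x); rewrite -ball_normE /ball_ /= sub0r normrN -nrm_complex ltcR.
rewrite nrmZr ?(ltW c0) // linear0 sub0r normrN -nrm_complex -[1]/(1%:C%C) lecR linearZ /=.
rewrite nrmZr ?(ltW c0) // /c divfK ?gt_eqF // ltr_pdivrMr // ltr_pMr // ltr1n => /(_ isT) h.
have -> : nrm (A x) = (r / 2 / nrm x * nrm (A x)) * (2 / r * nrm x).
  by field; rewrite !gt_eqF.
by apply: ler_piMl => //; rewrite mulr_ge0 ?divr_ge0 ?nrm_ge0 // ltW.
Qed.

(** * The stable set *)

Section StableSet.
Variables (R : realType) (V : completeNormedModType R[i]) (ip : V -> V -> R[i]).
Hypothesis hip : inner_product_of_norm ip.
Variables (A : {linear V -> V}) (C : R).
Hypotheses (C_ge0 : 0 <= C) (A_le : forall x, nrm (A x) <= C * nrm x).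
Variables (F : (int -> V) -> (int -> V)).
Hypotheses (hcaus : causal F) (hF0 : F (fun=> 0) = (fun=> 0)).
Local Notation P := (riesz_plus A).
Local Notation Q := (riesz_minus A).

Variables (rho : R) (F2 : (int -> V) -> (int -> V)) (L2 : R).
Hypotheses (rho_gt0 : 0 < rho) (hrho : spectral_radius A < rho).
Hypothesis hF2 : lipschitz_extension rho F F2 L2.
Hypothesis hL2 : L2 * resolvent_sup A rho < 1.

Let outside z : rho <= cabs z -> ~ in_spectrum A z.
Proof. exact: (not_in_spectrum C_ge0 A_le hrho). Qed.

Let circle_rho z : cabs z = rho -> ~ in_spectrum A z.
Proof. by move=> h; apply: outside; rewrite h. Qed.

Let M2 := resolvent_sup A rho.
Let M2_ge0 : 0 <= M2 := (resolvent_sup_lb A_le (ltW rho_gt0) circle_rho).1.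
Let lb2 : lower_bound A rho M2 := (resolvent_sup_lb A_le (ltW rho_gt0) circle_rho).2.

(** Solutions are the fixed points of [u |-> S (F2 u + delta_m1 x)], a contraction with factor
    [M2 L2]. Causality and [forward_support] keep the iterates zero on [k < 0], and uniqueness gives
    every solution this support. *)
Lemma exists_unique_S x : exists u, [/\ S_solution A F2 rho x u, forall k, k < 0 -> u k = 0 &
  forall v, S_solution A F2 rho x v -> u = v].
Proof.
have [t ht pb] := power_bounded_below_rho hip C_ge0 A_le rho_gt0 outside.
have [S [Sin Se Slip]] := solution_operator hip C_ge0 A_le rho_gt0 M2_ge0 lb2
  (fun x => ex_intro2 _ _ (forward_orbit A x) (@in_l2w_forward_orbit _ _ A _ _ x ht pb)
              (tauA_forward_orbit A x)).
have [F2in _ _ _] := hF2.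
pose src u := fun k => F2 u k + delta_m1 x k.
have srcin u : in_l2w rho u -> in_l2w rho (src u).
  by move=> hu; apply: in_l2wD => //; [exact: F2in|exact: in_l2w_delta].
pose Phi u := S (src u).
have fixE u : S_solution A F2 rho x u <-> in_l2w rho u /\ Phi u = u.
  split=> -[hu ue]; split=> //.
    apply: (tauA_inj hip C_ge0 A_le rho_gt0 M2_ge0 lb2) => //; first exact/Sin/srcin.
    by move=> k; rewrite (Se _ (srcin _ hu)) /tauA ue -[A _ + _ + _]addrA [A _ + _]addrC addrK.
  move=> k; have := Se _ (srcin u hu) k; rewrite -/(Phi u) ue /tauA /src => /eqP.
  by rewrite subr_eq => /eqP ->; rewrite addrC addrA.
have L0 : 0 <= L2 by case: hF2.
have q0 : 0 <= M2 * L2 by rewrite mulr_ge0.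
have q1 : M2 * L2 < 1 by rewrite mulrC.
have ctr u v c : in_l2w rho u -> in_l2w rho v -> 0 <= c -> l2bd rho (fun k => u k - v k) c ->
    l2bd rho (fun k => Phi u k - Phi v k) (M2 * L2 * c).
  move=> hu hv c0 h; rewrite -mulrA.
  apply: Slip; [exact: srcin|exact: srcin|exact: mulr_ge0|].
  apply: (l2bd_ext (v := fun k => F2 u k - F2 v k)); last exact: (lipschitz_l2bd rho_gt0 hF2).
  by move=> k; rewrite /src opprD addrACA subrr addr0.
have [|||u [hu u0 ue]] := contraction_fixed_point rho_gt0 q0 q1 ctr
  (D := fun u => forall k, k < 0 -> u k = 0) => //.
- move=> u hu u0; have Pu : in_l2w rho (Phi u) by exact/Sin/srcin.
  split=> //; apply: (forward_support ht pb Pu) => k k1.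
  rewrite Se; last exact: srcin.
  rewrite /src (extension_causal rho_gt0 hF2 hcaus hF0 hu u0) ?(lt_trans k1) //.
  by rewrite add0r /delta_m1 lt_eqF.
- move=> u_ u hu_ hlim k k0; apply: (vconv_unique (hlim k)).
  have -> : u_^~ k = (fun=> 0) by apply/funext => n; exact: hu_.
  exact: vconv_cst.
exists u; split=> //; first exact/fixE.
by move=> v /fixE[hv ve]; exact: (contraction_unique rho_gt0 q0 q1 ctr).
Qed.

Variables (F1 : (int -> V) -> (int -> V)) (L1 : R).
Hypothesis hhyp : hyperbolic A.
Hypothesis hF1 : lipschitz_extension 1 F F1 L1.
Hypothesis hL1 : L1 * resolvent_sup A 1 < 1.

Let gt01 : 0 < 1 :> R := ltr01.
Let M1 := resolvent_sup A 1.
Let M1_ge0 : 0 <= M1 := (resolvent_sup_lb A_le ler01 hhyp).1.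
Let lb1 : lower_bound A 1 M1 := (resolvent_sup_lb A_le ler01 hhyp).2.

Let resolvent_circle z (hz : cabs z = 1) x :
  z *: resolvent A z x - A (resolvent A z x) = x := resolvent_eq hhyp x hz.

(** Injectivity of [tau - A] forces the witness [g] to be [S (F1 w + delta_m1 xi)], so [Phi] has the
    right fixed points; cutting with [chi_nonneg] increases no norm and keeps the factor [M1 L1]. *)
Lemma exists_unique_T xi : exists! w, T_fixed_point A F1 xi w.
Proof.
have [S [Sin Se Slip]] := solution_operator hip C_ge0 A_le gt01 M1_ge0 lb1
  (fun x => let: ex_intro h (And3 a b _) := green hip C_ge0 A_le M1_ge0 lb1 resolvent_circle x in
            ex_intro2 _ _ h a b).
have [F1in _ _ _] := hF1.
pose src w := fun k => F1 w k + delta_m1 xi k.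
have srcin w : in_l2w 1 w -> in_l2w 1 (src w).
  by move=> hw; apply: in_l2wD => //; [exact: F1in|exact: in_l2w_delta].
pose Phi w := chi_nonneg (S (src w)).
have fixE w : T_fixed_point A F1 xi w <-> in_l2w 1 w /\ Phi w = w.
  split=> [[hw [g [gin ge we]]]|[hw we]]; split=> //.
    rewrite [RHS]we; congr chi_nonneg.
    apply: (tauA_inj hip C_ge0 A_le gt01 M1_ge0 lb1) => //; first exact/Sin/srcin.
    by move=> k; rewrite (Se _ (srcin _ hw)); exact/esym/ge.
  by exists (S (src w)); split=> //; [exact/Sin/srcin|move=> k; exact/Se/srcin].
have L0 : 0 <= L1 by case: hF1.
have q0 : 0 <= M1 * L1 by rewrite mulr_ge0.
have q1 : M1 * L1 < 1 by rewrite mulrC.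
have ctr u v c : in_l2w 1 u -> in_l2w 1 v -> 0 <= c -> l2bd 1 (fun k => u k - v k) c ->
    l2bd 1 (fun k => Phi u k - Phi v k) (M1 * L1 * c).
  move=> hu hv c0 h; rewrite -[_ * c]mul1r.
  apply: (l2bd_dom gt01 ler01 (fun k => chi_nonneg_le _ _ k)); rewrite -mulrA.
  apply: Slip; [exact: srcin|exact: srcin|exact: mulr_ge0|].
  apply: (l2bd_ext (v := fun k => F1 u k - F1 v k)); last exact: (lipschitz_l2bd gt01 hF1).
  by move=> k; rewrite /src opprD addrACA subrr addr0.
have [|||w [hw _ we]] := contraction_fixed_point gt01 q0 q1 ctr (D := fun=> True) => //.
  by move=> u hu _; split=> //; apply/in_l2w_chi/Sin/srcin.
exists w; split; first exact/fixE.
by move=> w' /fixE[hw' we']; exact: (contraction_unique gt01 q0 q1 ctr).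
Qed.

Lemma extensions_agree u : in_l2w 1 u -> in_l2w rho u -> F1 u = F2 u.
Proof.
move=> h1 h2; apply/funext => k.
exact: (vconv_unique (extension_lim gt01 hF1 k h1) (extension_lim rho_gt0 hF2 k h2)).
Qed.

Lemma stable_set x :
  (exists u, S_solution A F2 rho x u /\ in_l2w 1 u) <->
  (exists xi w, [/\ range P xi, T_fixed_point A F1 xi w & x = xi + Q (w 0)]).
Proof.
split=> [[u [hu u1]]|[xi [w [[y _ <-] [w1 [g [gin ge wg]]] xE]]]].
  have [v [_ v0 /(_ u hu) vu]] := exists_unique_S x; subst v.
  have [u2 ue] := hu.
  have F12 := extensions_agree u1 u2.
  have u0x : u 0 = x.
    have := ue (-1); rewrite addNr (v0 (-1)) // linear0 add0r /delta_m1 eqxx.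
    by rewrite (extension_causal rho_gt0 hF2 hcaus hF0 u2 v0) // add0r.
  exists (P x), u; split; first by exists x.
    split=> //.
    (* Subtracting the Green function of [x - P x] turns the source [x] into [P x] and leaves the
       entries at [k >= 0] unchanged, because [P (x - P x) = 0]. *)
    have [h [hin he h0]] := green hip C_ge0 A_le M1_ge0 lb1 resolvent_circle (x - P x).
    exists (fun k => u k - h k); split.
    - exact: in_l2wB.
    - move=> k; have uk : tauA A u k = F2 u k + delta_m1 x k.
        by rewrite /tauA ue -[A _ + _ + _]addrA [A _ + _]addrC addrK.
      rewrite -/(tauA A (fun k => u k - h k) k) tauAB uk he F12 /delta /delta_m1 -addrA.
      by case: ifP => _; rewrite ?subKr ?subr0.
    - apply/funext => -[n|n]; rewrite /chi_nonneg /=; last by rewrite v0.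
      rewrite (green_forward hip C_ge0 A_le M1_ge0 lb1 resolvent_circle n hin he).
      rewrite (riesz_plusB hip C_ge0 A_le M1_ge0 lb1 resolvent_circle).
      rewrite (riesz_plus_idem hip C_ge0 A_le M1_ge0 lb1 resolvent_circle).
      by rewrite subrr iter_linear0 subr0.
  by rewrite /riesz_minus u0x addrC subrK.
have w0 k : k < 0 -> w k = 0 by rewrite wg /chi_nonneg leNgt => ->.
have Fw k : k < 0 -> F1 w k = 0 := extension_causal gt01 hF1 hcaus hF0 w1 w0 (k := k).
(* For [rho < 1] the forward supported solution in [l_{2,rho}] already lies in [l_2]; for [rho >= 1]
   the sequence [w] itself lies in both spaces and is shown to be the solution. *)
have [rho1|rho1] := ltP rho 1.
  have [u [hu u0 _]] := exists_unique_S x; exists u; split=> //.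
  by apply: (in_l2w_mono rho_gt0 (ltW rho1) u0); case: hu.
have w2 : in_l2w rho w by apply: (in_l2w_mono gt01 rho1 w0).
(* On [k < -1] the source vanishes, so [g] is a backward orbit and [P (g (-1)) = 0]; the equation at
   [-1] reads [g 0 = A (g (-1)) + P y]. *)
have Pg : P (g 0) = P y.
  have gm : P (g (-1)) = 0.
    apply: (riesz_plus_backward hip C_ge0 A_le M1_ge0 lb1 resolvent_circle gin) => k k1.
    have /eqP := ge k; rewrite Fw ?(lt_trans k1) // add0r /delta_m1 lt_eqF // subr_eq0.
    by move/eqP.
  have := ge (-1); rewrite addNr Fw // add0r /delta_m1 eqxx => h.
  have := riesz_plusB hip C_ge0 A_le M1_ge0 lb1 resolvent_circle (g 0) (A (g (-1))).
  rewrite h (riesz_plus_idem hip C_ge0 A_le M1_ge0 lb1 resolvent_circle).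
  rewrite (riesz_plusA hip C_ge0 A_le M1_ge0 lb1 resolvent_circle) gm linear0 subr0.
  by move=> ->.
(* [x = P y + Q (g 0) = P (g 0) + Q (g 0) = g 0]; this supplies the equation of [w] at [k = -1]. *)
have wx : w 0 = x.
  by rewrite xE wg /chi_nonneg /= /riesz_minus Pg addrC subrK.
exists w; split=> //; split=> // -[n|[|n]]; rewrite -(extensions_agree w1 w2).
- have wgE m : w (Posz m) = g (Posz m) by rewrite wg.
  have := ge (Posz n); rewrite (_ : Posz n + 1 = Posz n.+1) ?wgE; last by rewrite -PoszD addn1.
  by rewrite /delta_m1 !addr0 => /eqP; rewrite subr_eq addrC => /eqP.
- by rewrite (_ : Negz 0 + 1 = 0) // wx w0 // linear0 add0r Fw // add0r.
- rewrite NegzS_succ.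
  by rewrite !w0 // linear0 Fw // !add0r /delta_m1.
Qed.

End StableSet.

Theorem theorem4p12 (R : realType) (V : completeNormedModType R[i])
  (ip : V -> V -> R[i]) (hip : inner_product_of_norm ip)
  (hsep : separable_space V)
  (A : V -> V) (hA : bounded_linear A) (hhyp : hyperbolic A)
  (rho : R) (hrho0 : 0 < rho) (hrho : spectral_radius A < rho)
  (F : (int -> V) -> (int -> V))
  (hadm : admissible 1 rho F) (hcaus : causal F)
  (hF0 : F (fun _ => 0) = (fun _ => 0))
  (F1 F2 : (int -> V) -> (int -> V)) (L1 L2 : R)
  (hF1 : lipschitz_extension 1 F F1 L1)
  (hF2 : lipschitz_extension rho F F2 L2)
  (hL1 : L1 * resolvent_sup A 1 < 1)
  (hL2 : L2 * resolvent_sup A rho < 1) :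
  let P := riesz_plus A in
  let Q := riesz_minus A in
  [/\ (* T(xi) is well defined: unique fixed point in l_2 *)
      forall xi : V, range P xi -> exists! w : int -> V, T_fixed_point A F1 xi w,
      (* S_rho(x) is well defined: unique solution in l_{2,rho} *)
      forall x : V, exists! u : int -> V, S_solution A F2 rho x u
    & (* W^s = { xi + w^s(xi) : xi in P[H] }, with w^s(xi) = Q (T(xi)_0) *)
      forall x : V,
        (exists u : int -> V, S_solution A F2 rho x u /\ in_l2w 1 u) <->
        (exists (xi : V) (w : int -> V),
            [/\ range P xi, T_fixed_point A F1 xi w & x = xi + Q (w 0)])].
Proof.
have [linA contA] := hA.
pose B : {linear V -> V} := HB.pack A (GRing.isLinear.Build R[i] V V *:%R A linA).
have [C C0 hC] : exists2 C : R, 0 <= C & forall x, nrm (B x) <= C * nrm x.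
  exact: continuous_linear_bounded.
move=> P Q; split.
- by move=> xi _; exact: (exists_unique_T hip C0 hC hhyp hF1 hL1).
- move=> x; have [u [hu _ uniq]] :=
    exists_unique_S hip C0 hC hcaus hF0 hrho0 hrho hF2 hL2 x.
  by exists u.
- exact: (stable_set hip C0 hC hcaus hF0 hrho0 hrho hF2 hL2 hhyp hF1).
Qed.
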